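(* Let $q \in \mathbb{N}$ be even, let $X \in \mathbb{R}^{n \times d}$ and $\alpha > 0$. There exists an algorithm running in time $O(n^2 d^2 + n d^3)$ that, given $X$, outputs a list $L$ containing $O(n+d)$ unit vectors (in the Euclidean norm) in $\mathbb{R}^d$ such that \[ \|X\|_{2 \to \bar q} \le d^{1/4 - 1/(2q)} \cdot \max_{\hat v \in L} \|X \hat v\|_{\bar q} \le d^{1/4 - 1/(2q)} \cdot \|X\|_{2 \to \bar q}. \] Consequently, by computing $\|X\hat v\|_{\bar q}$ for all $\hat v \in L$, in the same time one can: (1) certify that $\|X\|_{2\to\bar q} \le \alpha \cdot d^{1/4 - 1/(2q)}$ whenever $\|X\|_{2 \to \bar q} \le \alpha$; that is, output a number $\mathrm{ALG}(X)$ with $\|X\|_{2\to\bar q} \le \mathrm{ALG}(X)$ for every $X$, and $\mathrm{ALG}(X) \le \alpha \cdot d^{1/4-1/(2q)}$ whenever $\|X\|_{2\to\bar q}\le \alpha$; (2) compute a unit vector $\hat v \in \mathbb{R}^d$ such that $\|X \hat v\|_{\bar q} \ge \|X\|_{2\to \bar q} / d^{1/4 - 1/(2q)}$.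
   Context: For a vector $y \in \mathbb{R}^n$ and $q \ge 1$, the expectation norm is $\|y\|_{\bar q} = \left(\frac1n \sum_{i=1}^n |y_i|^q\right)^{1/q}$. For $X \in \mathbb{R}^{n\times d}$, $\|X\|_{2 \to \bar q} = \sup_{v \in \mathbb{R}^d, \|v\|_2 = 1} \|Xv\|_{\bar q}$ (equivalently $n^{-1/q}\sup_{\|v\|_2=1}\|Xv\|_q$). Running time is measured in arithmetic operations.
   Formalization: Arithmetic operations are taken to include the largest real root of a polynomial of degree m, charged (m+1)^3, since field operations alone cannot produce the exact norms and singular vectors required; n, d ≥ 1, q ≥ 2, and the O-constants may depend on q. *)

(* Defs.v *)
From HB Require Import structures.
From mathcomp Require Import all_boot all_order all_algebra.
From mathcomp Require Import boolp classical_sets reals exp.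

Set Implicit Arguments.
Unset Strict Implicit.
Unset Printing Implicit Defensive.

Import Order.TTheory GRing.Theory Num.Theory.

Local Open Scope classical_set_scope.
Local Open Scope ring_scope.

Section Norms.
Variable R : realType.

Definition norm2 d (v : 'cV[R]_d) : R := Num.sqrt (\sum_(j < d) v j 0 ^+ 2).

Definition expnorm (q : R) n (y : 'cV[R]_n) : R :=
  (n%:R^-1 * \sum_(i < n) `|y i 0| `^ q) `^ q^-1.

Definition norm2to (q : R) n d (X : 'M[R]_(n, d)) : R :=
  sup [set expnorm q (X *m v) | v in [set v : 'cV[R]_d | norm2 v = 1]].

End Norms.

(** A real RAM, given as a structured language.  The machine has natural-number
    registers, used for indices and loop bounds, and a real memory made of
    two-dimensional arrays [a] with cells [a[i][j]].  The real instructions are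
    the four field operations, comparison, and extraction of the largest real
    root of a univariate polynomial.  The latter covers square roots and
    [k]-th roots, and something of the kind is unavoidable: for [q = 2] the
    approximation factor is 1, so an exact leading singular vector has to be
    output, and its coordinates are in general not expressible by radicals in
    the entries of the matrix.  No real constants other than natural numbers
    are available, and all loops are bounded, so that every program halts. *)

Inductive iexp : Type :=
| IVar of nat
| INum of nat
| IAdd of iexp & iexp
| ISub of iexp & iexp.

Fixpoint ieval (s : nat -> nat) (e : iexp) : nat :=
  match e with
  | IVar x => s x
  | INum k => k
  | IAdd e1 e2 => (ieval s e1 + ieval s e2)%N
  | ISub e1 e2 => (ieval s e1 - ieval s e2)%N
  end.

Fixpoint icost (e : iexp) : nat :=
  match e with
  | IVar _ | INum _ => 1
  | IAdd e1 e2 | ISub e1 e2 => (icost e1 + icost e2).+1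
  end.

Record cell : Type := Cell { cell_arr : nat; cell_row : iexp; cell_col : iexp }.

Definition ccost (a : cell) : nat := (icost (cell_row a) + icost (cell_col a))%N.

Inductive rop : Type := Radd | Rsub | Rmul | Rdiv.

(** - [SetR a e]: store the natural number [e], as a real, in cell [a].
    - [RootR a b r m]: store in cell [a] the largest real root of
      [\sum_(k <= m) b[r][k] x^k].
    - [IfI e1 e2 c1 c2], [IfR a b c1 c2]: run [c1] if [e1 <= e2] (resp. if the
      content of [a] is at most that of [b]), and [c2] otherwise.
    - [For x e c]: run [c] with [x] set to [0], ..., [e - 1] in turn, where [e]
      is evaluated once, before the loop. *)
Inductive cmd : Type :=
| Skip
| Seq of cmd & cmd
| SetI of nat & iexp
| SetR of cell & iexp
| CopyR of cell & cell
| OpR of rop & cell & cell & cell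
| RootR of cell & nat & iexp & iexp
| IfI of iexp & iexp & cmd & cmd
| IfR of cell & cell & cmd & cmd
| For of nat & iexp & cmd.

Section Machine.
Variable R : realType.

Record state : Type := State {
  ireg : nat -> nat;
  rmem : nat -> nat -> nat -> R;
  clock : nat }.

Definition tick (k : nat) (s : state) : state :=
  State (ireg s) (rmem s) (clock s + k).

Definition seti (x k : nat) (s : state) : state :=
  State (fun y => if y == x then k else ireg s y) (rmem s) (clock s).

Definition getr (a : cell) (s : state) : R :=
  rmem s (cell_arr a) (ieval (ireg s) (cell_row a)) (ieval (ireg s) (cell_col a)).

Definition setr (a : cell) (r : R) (s : state) : state :=
  let i0 := ieval (ireg s) (cell_row a) in
  let j0 := ieval (ireg s) (cell_col a) in
  State (ireg s)
    (fun b i j => if [&& b == cell_arr a, i == i0 & j == j0] then r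
                  else rmem s b i j)
    (clock s).

(** Division by zero yields zero. *)
Definition rop_eval (o : rop) (x y : R) : R :=
  match o with
  | Radd => x + y
  | Rsub => x - y
  | Rmul => x * y
  | Rdiv => x / y
  end.

(** A maximum whenever [p] is nonzero and has a real root; [0] otherwise, since
    [sup] is [0] on the empty set and on unbounded sets. *)
Definition largest_root (p : {poly R}) : R := sup [set x | root p x].

(** Every instruction is charged 1 plus the size of the index expressions in it,
    every loop iteration is charged 1 more than its body, and a root of a
    polynomial of degree [m] is charged [(m + 1)^3], the usual cost of finding
    polynomial roots as eigenvalues of a companion matrix. *)
Fixpoint run (c : cmd) (s : state) {struct c} : state :=
  match c with
  | Skip => tick 1 s
  | Seq c1 c2 => run c2 (run c1 s)
  | SetI x e => tick (icost e).+1 (seti x (ieval (ireg s) e) s)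
  | SetR a e => tick (ccost a + icost e).+1 (setr a (ieval (ireg s) e)%:R s)
  | CopyR a b => tick (ccost a + ccost b).+1 (setr a (getr b s) s)
  | OpR o a b1 b2 =>
      tick (ccost a + ccost b1 + ccost b2).+1
           (setr a (rop_eval o (getr b1 s) (getr b2 s)) s)
  | RootR a b r m =>
      let k := ieval (ireg s) m in
      let p := \poly_(i < k.+1) rmem s b (ieval (ireg s) r) i in
      tick (ccost a + icost r + icost m + k.+1 ^ 3).+1
           (setr a (largest_root p) s)
  | IfI e1 e2 c1 c2 =>
      let s' := tick (icost e1 + icost e2).+1 s in
      if (ieval (ireg s) e1 <= ieval (ireg s) e2)%N then run c1 s' else run c2 s'
  | IfR a b c1 c2 =>
      let s' := tick (ccost a + ccost b).+1 s in
      if getr a s <= getr b s then run c1 s' else run c2 s'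
  | For x e c1 =>
      iteri (ieval (ireg s) e) (fun i s' => run c1 (tick 1 (seti x i s')))
            (tick (icost e).+1 s)
  end.

(** Input convention: register 0 holds [n], register 1 holds [d], array 0 holds
    the entries of [X]; everything else is zero. *)
Definition init n d (X : 'M[R]_(n, d)) : state :=
  State
    (fun x => if x == 0%N then n else if x == 1%N then d else 0%N)
    (fun a i j =>
       if a == 0%N then
         if (insub i : option 'I_n) is Some i' then
           if (insub j : option 'I_d) is Some j' then X i' j' else 0
         else 0
       else 0)
    0%N.

Definition run_on (P : cmd) n d (X : 'M[R]_(n, d)) : state := run P (init X).

Definition runtime (P : cmd) n d (X : 'M[R]_(n, d)) : nat := clock (run_on P X).

(** Output conventions: a number is returned in cell [[0][0]] of array 1, a
    vector of [R^d] in the first [d] cells of row 0 of array 1, and a list of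
    vectors in the successive rows of array 1, with its length in register 2. *)
Definition row_of_memory d (s : state) (k : nat) : 'cV[R]_d :=
  \col_(j < d) rmem s 1 k j.

Definition out_num (P : cmd) n d (X : 'M[R]_(n, d)) : R :=
  rmem (run_on P X) 1 0 0.

Definition out_vec (P : cmd) n d (X : 'M[R]_(n, d)) : 'cV[R]_d :=
  row_of_memory d (run_on P X) 0.

Definition out_list (P : cmd) n d (X : 'M[R]_(n, d)) : seq 'cV[R]_d :=
  [seq row_of_memory d (run_on P X) k | k <- iota 0 (ireg (run_on P X) 2)].

End Machine.

(** Running in time [O(n^2 d^2 + n d^3)], uniformly over all inputs. *)
Definition time_bounded (R : realType) (P : cmd) : Prop :=
  exists C : nat, forall (n d : nat) (X : 'M[R]_(n, d)),
    (0 < n)%N -> (0 < d)%N ->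
    (runtime P X <= C * (n ^ 2 * d ^ 2 + n * d ^ 3))%N.

(* Main.v *)
Require Import Defs.
From mathcomp Require Import all_boot all_order all_algebra.
From mathcomp Require Import boolp classical_sets reals exp.
From mathcomp Require Import ring lra zify.

(** Write [q = 2 m + 2], let [x_i] be the rows of [X] and
    [F v = \sum_i <x_i, v> ^ q], so that [F] is [n] times the [q]-th power of the
    norm.  The list consists of the normalized rows [a_i] and, for each [i], of a
    unit vector [u_i] maximizing [T_i u = \sum_j <x_i, x_j> ^ (2 m) <x_j, u> ^ 2].
    If [F <= B] on the list, Hoelder gives [T_i u_i <= B |x_i| ^ (2 m)].  For a
    unit vector [v] let [N] be the sum of [<x_i, v> ^ 2 y_i y_i^T], where [y_i] is
    the [m]-th tensor power of [x_i].  Then [F v <= |N|] in the Frobenius norm,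
    [|N| ^ 2 = \sum_i <x_i, v> ^ 2 T_i v <= B tr N], and
    [tr N <= sqrt (d ^ m) |N|] since [N] has order [d ^ m]; hence
    [F v <= sqrt (d ^ m) B].

    The vector [u_i] is a top eigenvector of a symmetric matrix, found exactly
    with [O(d ^ 3)] operations: the Lanczos process, restarted whenever it breaks
    down, yields an orthogonal basis in which the matrix is tridiagonal, the
    characteristic polynomial follows from a three-term recurrence, its largest
    root [lam] is one instruction, and a kernel vector of [M - lam] is obtained by
    deflating the identity by the rows of [M - lam]. *)

Set Implicit Arguments.
Unset Strict Implicit.
Unset Printing Implicit Defensive.

Import Order.TTheory GRing.Theory Num.Theory.
Local Open Scope ring_scope.

(** * Costs and frames *)

Section MachineTheory.
Variable R : realType.
Implicit Types (s : state R) (c : cmd) (e : iexp).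

(** [F] has degree [q] and is hard to maximize directly. In the expansion of [|N| ^ 2], however,
    each [T_i v] is a quadratic form in [v], so it can be replaced by its exact maximum, which is
    found without knowing [v]. The tensors serve the analysis only and are never computed. The loss
    arises where [N] is compared with its trace: the [q]-th root of [sqrt (d ^ m)] is
    [d ^ (m / (2 q))], and [m / (2 q) = 1/4 - 1/(2 q)].

    The time bound leaves O(n d^2 + d^3) operations per row. The first term pays for the matrix of
    [T_i], the second for its eigenvector. A root of degree [d] alone is charged [(d + 1) ^ 3], so
    the characteristic polynomial and the kernel vector must each come from [d] rounds of O(d^2)
    work. In both, a round updates the projection onto the complement of the vectors met so far. In
    exact arithmetic a Lanczos breakdown is a residual equal to zero, and a restart only makes an
    off-diagonal entry of the tridiagonal matrix vanish. *)

Lemma iteri_inv (S : Type) (I : nat -> S -> Prop) (f : nat -> S -> S) k (s : S) :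
  I 0%N s -> (forall i t, (i < k)%N -> I i t -> I i.+1 (f i t)) ->
  I k (iteri k f s).
Proof.
move=> I0 +; elim: k => //= k IH stepI.
by apply: (stepI) => //; apply: IH => i t /ltnW; exact: stepI.
Qed.

(** A syntactic over-approximation, so that for concrete programs the side condition of [run_frame]
    holds by computation; [iwrites] does the same for registers. *)
Fixpoint writes (x : nat) c : bool :=
  match c with
  | Seq c1 c2 | IfI _ _ c1 c2 | IfR _ _ c1 c2 => writes x c1 || writes x c2
  | SetR a _ | CopyR a _ | OpR _ a _ _ | RootR a _ _ _ => cell_arr a == x
  | For _ _ c1 => writes x c1
  | Skip | SetI _ _ => false
  end.

Fixpoint iwrites (x : nat) c : bool :=
  match c with
  | Seq c1 c2 | IfI _ _ c1 c2 | IfR _ _ c1 c2 => iwrites x c1 || iwrites x c2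
  | SetI y _ => x == y
  | For y _ c1 => (x == y) || iwrites x c1
  | _ => false
  end.

Lemma run_frame (x : nat) c s : ~~ writes x c -> rmem (run c s) x = rmem s x.
Proof.
elim: c s => //=.
- by move=> c1 IH1 c2 IH2 s; rewrite negb_or => /andP[/IH1 h1 /IH2 h2]; rewrite h2 h1.
- by move=> a e s; rewrite eq_sym => /negbTE h; apply/funext => i; apply/funext=> j; rewrite h.
- by move=> a b s; rewrite eq_sym => /negbTE h; apply/funext => i; apply/funext=> j; rewrite h.
- by move=> o a b b' s; rewrite eq_sym => /negbTE h; apply/funext => i; apply/funext=> j; rewrite h.
- by move=> a b r m s; rewrite eq_sym => /negbTE h; apply/funext => i; apply/funext=> j; rewrite h.
- move=> e1 e2 c1 IH1 c2 IH2 s; rewrite negb_or => /andP[/IH1 h1 /IH2 h2].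
  by case: ifP; rewrite ?h2 ?h1.
- move=> e1 e2 c1 IH1 c2 IH2 s; rewrite negb_or => /andP[/IH1 h1 /IH2 h2].
  by case: ifP; rewrite ?h2 ?h1.
- move=> y e c1 IH1 s h1.
  apply: (iteri_inv (I := fun _ t => rmem t x = rmem s x)) => // i t _ <-.
  by rewrite IH1.
Qed.

Lemma run_iframe (x : nat) c s : ~~ iwrites x c -> ireg (run c s) x = ireg s x.
Proof.
elim: c s => //=.
- by move=> c1 IH1 c2 IH2 s; rewrite negb_or => /andP[/IH1 h1 /IH2 h2]; rewrite h2 h1.
- by move=> y e s /negbTE ->.
- move=> e1 e2 c1 IH1 c2 IH2 s; rewrite negb_or => /andP[/IH1 h1 /IH2 h2].
  by case: ifP; rewrite ?h2 ?h1.
- move=> e1 e2 c1 IH1 c2 IH2 s; rewrite negb_or => /andP[/IH1 h1 /IH2 h2].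
  by case: ifP; rewrite ?h2 ?h1.
- move=> y e c1 IH1 s; rewrite negb_or => /andP[/negbTE h h1].
  apply: (iteri_inv (I := fun _ t => ireg t x = ireg s x)) => // i t _ <-.
  by rewrite IH1 //= h.
Qed.

(** Exponents [(a, b)] with the value of [e] in O(n^a d^b). For a sum the maxima suffice because [n]
    and [d] are positive. Registers other than 0 and 1 give [None], since their content is not
    visible in the syntax. *)
Fixpoint edeg e : option (nat * nat) :=
  match e with
  | INum _ => Some (0, 0)%N
  | IVar 0 => Some (1, 0)%N
  | IVar 1 => Some (0, 1)%N
  | IAdd e1 e2 =>
      match edeg e1, edeg e2 with
      | Some p1, Some p2 => Some (maxn p1.1 p2.1, maxn p1.2 p2.2)
      | _, _ => None
      end
  | _ => None
  end.

Definition budget (n d : nat) : nat := (n ^ 2 * d ^ 2 + n * d ^ 3)%N.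

Definition within (a b : nat) : bool :=
  ((a <= 2) && (b <= 2) || (a <= 1) && (b <= 3))%N.

(** [fits a b c] certifies that the worst-case cost of [c], multiplied by
    [n ^ a * d ^ b], is in [O(budget n d)]: the pair [(a, b)] accounts for the
    loops around [c], and loop bounds may only involve the registers [n], [d]. *)
Fixpoint fits (a b : nat) c : bool :=
  match c with
  | Seq c1 c2 => fits a b c1 && fits a b c2
  | IfI _ _ c1 c2 | IfR _ _ c1 c2 => [&& within a b, fits a b c1 & fits a b c2]
  | SetI x _ => (1 < x)%N && within a b
  | RootR _ _ _ e =>
      if edeg e is Some p then within (a + p.1 * 3)%N (b + p.2 * 3)%N else false
  | For x e c1 =>
      if edeg e is Some p then
        [&& (1 < x)%N, within (a + p.1)%N (b + p.2)%N & fits (a + p.1)%N (b + p.2)%N c1]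
      else false
  | _ => within a b
  end.

Lemma withinP a b n d : within a b -> (0 < n)%N -> (0 < d)%N ->
  (n ^ a * d ^ b <= budget n d)%N.
Proof.
move=> + n0 d0; rewrite /budget => /orP[]/andP[ha hb].
  by apply: leq_trans (leq_addr _ _); rewrite leq_mul // leq_pexp2l.
by apply: leq_trans (leq_addl _ _); rewrite -[X in (_ <= X * _)%N]expn1 leq_mul // leq_pexp2l.
Qed.

Lemma edegP e p : edeg e = Some p ->
  exists C, forall r : nat -> nat, (0 < r 0)%N -> (0 < r 1)%N ->
    (ieval r e <= C * (r 0 ^ p.1 * r 1 ^ p.2))%N.
Proof.
elim: e p => //=.
- by move=> [|[|x]] //= p [<-]; exists 1%N => r _ _; rewrite expn0 expn1 ?mul1n ?muln1.
- by move=> k p [<-]; exists k => r _ _; rewrite !expn0 !muln1.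
move=> e1 IH1 e2 IH2 p.
case: (edeg e1) IH1 => [p1|//] IH1; case: (edeg e2) IH2 => [p2|//] IH2 [<-] /=.
have [C1 h1] := IH1 _ erefl; have [C2 h2] := IH2 _ erefl.
exists (C1 + C2)%N => r r0 r1; rewrite mulnDl.
apply: leq_add.
  apply: leq_trans (h1 r r0 r1) _.
  by rewrite leq_mul // leq_mul // leq_pexp2l // leq_max leqnn.
apply: leq_trans (h2 r r0 r1) _.
by rewrite leq_mul // leq_mul // leq_pexp2l // leq_max leqnn orbT.
Qed.

(** The semantic counterpart of [fits]: [K] bounds one execution, and the weight [n ^ a * d ^ b]
    counts the executions caused by the enclosing loops. Registers 0 and 1 are preserved so that
    later loop bounds still refer to the input sizes. *)
Definition costs (a b : nat) c := exists C (K : nat -> nat -> nat),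
  (forall n d, (0 < n)%N -> (0 < d)%N ->
     (n ^ a * d ^ b * K n d <= C * budget n d)%N) /\
  forall s, (0 < ireg s 0)%N -> (0 < ireg s 1)%N ->
    [/\ ireg (run c s) 0 = ireg s 0, ireg (run c s) 1 = ireg s 1 &
        (clock (run c s) <= clock s + K (ireg s 0) (ireg s 1))%N].

Lemma costs_const a b c k : within a b ->
  (forall s, [/\ ireg (run c s) 0 = ireg s 0, ireg (run c s) 1 = ireg s 1 &
     clock (run c s) = (clock s + k)%N]) ->
  costs a b c.
Proof.
move=> w h; exists k, (fun _ _ => k); split=> [n d n0 d0|s _ _].
  by rewrite mulnC leq_mul2l withinP // orbT.
by case: (h s) => -> -> ->.
Qed.

Lemma costs_if a b c1 c2 c k (t : state R -> bool) : within a b ->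
  (forall s, run c s = run (if t s then c1 else c2) (tick k s)) ->
  costs a b c1 -> costs a b c2 -> costs a b c.
Proof.
move=> w hc [C1 [K1 [b1 h1]]] [C2 [K2 [b2 h2]]].
exists (k + C1 + C2)%N, (fun n d => k + K1 n d + K2 n d)%N; split.
  move=> n d n0 d0; have := withinP w n0 d0.
  have := b1 n d n0 d0; have := b2 n d n0 d0; move: (budget n d) => B h2' h1' h.
  by rewrite !mulnDr !mulnDl !leq_add // mulnC leq_mul2l h orbT.
move=> s s0 s1; rewrite hc; case: ifP => _.
  by case: (h1 (tick k s) s0 s1) => /= -> -> h; split=> //; lia.
by case: (h2 (tick k s) s0 s1) => /= -> -> h; split=> //; lia.
Qed.

Lemma costs_for a b x e c p : (1 < x)%N -> edeg e = Some p ->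
  within (a + p.1)%N (b + p.2)%N -> costs (a + p.1)%N (b + p.2)%N c ->
  costs a b (For x e c).
Proof.
move=> x1 /edegP[Ce he] w [C [K [bK hK]]].
exists ((icost e).+1 + Ce * C.+1)%N,
  (fun n d => (icost e).+1 + Ce * (n ^ p.1 * d ^ p.2) * (K n d).+1)%N; split.
  move=> n d n0 d0; have := bK n d n0 d0; have := withinP w n0 d0.
  rewrite !expnD; set A := (n ^ a)%N; set A' := (n ^ p.1)%N.
  set B := (d ^ b)%N; set B' := (d ^ p.2)%N.
  have A'0 : (0 < A')%N by rewrite expn_gt0 n0.
  have B'0 : (0 < B')%N by rewrite expn_gt0 d0.
  move: (budget n d) => G h1 h2; rewrite mulnDr mulnDl leq_add //.
    rewrite mulnC leq_mul2l; apply/orP; right.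
    apply: leq_trans h1; rewrite leq_mul // leq_pmulr //.
  rewrite -[(Ce * _ * _.+1)%N]mulnA -[(Ce * _ * G)%N]mulnA mulnCA leq_mul2l.
  apply/orP; right.
  rewrite mulnA; apply: leq_trans (_ : (A * A' * (B * B') * (K n d).+1 <= _)%N).
    by rewrite leq_mul2r; apply/orP; right; rewrite mulnACA.
  by rewrite mulnS mulSn leq_add.
move=> s s0 s1 /=.
set f := (X in iteri _ X _).
set k := K (ireg s 0%N) (ireg s 1%N).
have := @iteri_inv _ (fun i t => [/\ ireg t 0 = ireg s 0, ireg t 1 = ireg s 1 &
  (clock t <= clock s + (icost e).+1 + i * k.+1)%N]) f (ieval (ireg s) e)
  (tick (icost e).+1 s).
case=> [|i t hi [t0 t1 ht]|-> -> h].
- by split => //=; lia.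
- have [] := hK (tick 1 (seti x i t)).
  + by rewrite /= ifN ?t0 //; case: (x) x1 => [|[]].
  + by rewrite /= ifN ?t1 //; case: (x) x1 => [|[]].
  rewrite /= !ifN; try by case: (x) x1 => [|[]].
  by rewrite t0 t1 -/k /f => -> -> h; split=> //; lia.
split=> //; apply: leq_trans h _; rewrite -addnA leq_add2l leq_add2l leq_mul2r.
by rewrite he // orbT.
Qed.

Lemma costs_root a b x y r e p : edeg e = Some p ->
  within (a + p.1 * 3)%N (b + p.2 * 3)%N -> costs a b (RootR x y r e).
Proof.
move=> /edegP[Ce he] w.
pose k := (ccost x + icost r + icost e)%N.
exists (k.+1 + Ce.+1 ^ 3)%N,
  (fun n d => k.+1 + (Ce * (n ^ p.1 * d ^ p.2)).+1 ^ 3)%N; split.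
  move=> n d n0 d0; have := withinP w n0 d0.
  rewrite !expnD !expnM; set A := (n ^ a)%N; set A' := (n ^ p.1)%N.
  set B := (d ^ b)%N; set B' := (d ^ p.2)%N.
  have A'0 : (0 < A')%N by rewrite expn_gt0 n0.
  have B'0 : (0 < B')%N by rewrite expn_gt0 d0.
  move: (budget n d) => G h1; rewrite mulnDr mulnDl leq_add //.
    rewrite mulnC leq_mul2l; apply/orP; right.
    by apply: leq_trans h1; rewrite leq_mul // leq_pmulr // expn_gt0 ?A'0 ?B'0.
  (* Since [A' * B'] is positive, the successor is absorbed by passing from [Ce] to [Ce.+1]. *)
  apply: leq_trans (_ : (A * B * (Ce.+1 ^ 3 * (A' ^ 3 * B' ^ 3)) <= _)%N).
    rewrite leq_mul2l; apply/orP; right; rewrite -!expnMn leq_exp2r //.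
    by rewrite mulSn -addn1 addnC leq_add2r muln_gt0 A'0.
  rewrite mulnCA leq_mul2l; apply/orP; right.
  by apply: leq_trans h1; rewrite mulnACA.
move=> s s0 s1 /=; split=> //; rewrite leq_add2l -addSn leq_add // leq_exp2r //.
by rewrite ltnS he.
Qed.

Lemma fitsP a b c : fits a b c -> costs a b c.
Proof.
elim: c a b => //=.
- by move=> a b w; apply: (costs_const (k := 1)).
- move=> c1 IH1 c2 IH2 a b /andP[/IH1[C1 [K1 [b1 h1]]] /IH2[C2 [K2 [b2 h2]]]].
  exists (C1 + C2)%N, (fun n d => K1 n d + K2 n d)%N; split.
    move=> n d n0 d0; have := b1 n d n0 d0; have := b2 n d n0 d0.
    by move: (budget n d) => G h2' h1'; rewrite mulnDr mulnDl leq_add.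
  move=> s s0 s1; case: (h1 s s0 s1) => e0 e1 h.
  case: (h2 (run c1 s)); rewrite ?e0 ?e1 //= => -> -> h'; split=> //.
  by apply: leq_trans h' _; rewrite addnA leq_add2r.
- move=> [|[|x]] //= e a b w; exact: (costs_const (k := (icost e).+1)).
- by move=> x e a b w; apply: (costs_const w).
- by move=> x e a b w; apply: (costs_const w).
- by move=> o x e e' a b w; apply: (costs_const w).
- move=> x y r e a b; case E: (edeg e) => [p|//]; exact: costs_root.
- move=> e1 e2 c1 IH1 c2 IH2 a b /and3P[w /IH1 h1 /IH2 h2].
  apply: (costs_if (t := fun s => (ieval (ireg s) e1 <= ieval (ireg s) e2)%N) w _ h1 h2).
  by move=> s /=; case: ifP.
- move=> e1 e2 c1 IH1 c2 IH2 a b /and3P[w /IH1 h1 /IH2 h2].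
  apply: (costs_if (t := fun s => getr e1 s <= getr e2 s) w _ h1 h2).
  by move=> s /=; case: ifP.
- move=> x e c1 IH1 a b; case E: (edeg e) => [p|//] /and3P[x1 w h].
  exact: costs_for E w (IH1 _ _ h).
Qed.

(** This reduces each running time claim to the evaluation of a boolean, independently of what the
    program computes. *)
Lemma fits_time_bounded c : fits 0 0 c -> time_bounded R c.
Proof.
move=> /fitsP[C [K [bK hK]]]; exists C => n d X n0 d0.
have := bK n d n0 d0; rewrite !expn0 !mul1n; apply: leq_trans.
by case: (hK (init X)).
Qed.

End MachineTheory.

(** * Compiling expressions *)

Fixpoint occurs (x : nat) (e : iexp) : bool :=
  match e with
  | IVar y => x == y
  | INum _ => false
  | IAdd e1 e2 | ISub e1 e2 => occurs x e1 || occurs x e2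
  end.

Definition update (r : nat -> nat) (x k : nat) : nat -> nat :=
  fun y => if y == x then k else r y.

Lemma eq_ieval (r r' : nat -> nat) e :
  (forall x, occurs x e -> r x = r' x) -> ieval r e = ieval r' e.
Proof.
elim: e => //= [x -> //|e1 IH1 e2 IH2 h|e1 IH1 e2 IH2 h]; rewrite ?eqxx //.
  by rewrite IH1 ?IH2 // => x hx; apply: h; rewrite hx ?orbT.
by rewrite IH1 ?IH2 // => x hx; apply: h; rewrite hx ?orbT.
Qed.

(** Real expressions.  In [RSum e E] the summation index is register 5, which
    [E] may mention and which ranges over [0], ..., [e - 1]; sums do not nest. *)
Inductive rexp : Type :=
| RCell of cell
| RNat of iexp
| ROp of rop & rexp & rexp
| RSum of iexp & rexp
| RPow of rexp & nat.

Definition cell_free (x : nat) (a : cell) : bool :=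
  ~~ occurs x (cell_row a) && ~~ occurs x (cell_col a).

(** The flag says that the expression lies under an [RSum], where register 5 may be mentioned.
    Register 6, the counter of [RPow], may never be. Compiled code can therefore overwrite its
    counters without changing what is still to be evaluated. *)
Fixpoint rscoped (b : bool) (E : rexp) : bool :=
  match E with
  | RCell a => (b || cell_free 5 a) && cell_free 6 a
  | RNat e => (b || ~~ occurs 5 e) && ~~ occurs 6 e
  | ROp _ E1 E2 => rscoped b E1 && rscoped b E2
  | RSum e E1 => [&& ~~ b, ~~ occurs 5 e, ~~ occurs 6 e & rscoped true E1]
  | RPow E1 _ => rscoped b E1
  end.

Fixpoint rreads (x : nat) (E : rexp) : bool :=
  match E with
  | RCell a => cell_arr a == x
  | RNat _ => false
  | ROp _ E1 E2 => rreads x E1 || rreads x E2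
  | RSum _ E1 | RPow E1 _ => rreads x E1
  end.

Fixpoint rbelow (t : nat) (E : rexp) : bool :=
  match E with
  | RCell a => (cell_arr a < t)%N
  | RNat _ => true
  | ROp _ E1 E2 => rbelow t E1 && rbelow t E2
  | RSum _ E1 | RPow E1 _ => rbelow t E1
  end.

Definition scal (a : nat) : cell := Cell a (INum 0) (INum 0).

(** The value of the expression is left in [scal t]; arrays below [t] are kept. *)
Fixpoint compile (t : nat) (E : rexp) : cmd :=
  match E with
  | RCell a => CopyR (scal t) a
  | RNat e => SetR (scal t) e
  | ROp o E1 E2 =>
      Seq (Seq (compile t E1) (compile t.+1 E2))
          (OpR o (scal t) (scal t) (scal t.+1))
  | RSum e E1 =>
      Seq (SetR (scal t) (INum 0))
          (For 5 e (Seq (compile t.+1 E1)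
                        (OpR Radd (scal t) (scal t) (scal t.+1))))
  | RPow E1 k =>
      Seq (Seq (compile t.+1 E1) (SetR (scal t) (INum 1)))
          (For 6 (INum k) (OpR Rmul (scal t) (scal t) (scal t.+1)))
  end.

(** Arrays from 30 on are scratch space for expressions. *)
Definition assign (a : cell) (E : rexp) : cmd :=
  Seq (compile 30 E) (CopyR a (scal 30)).

(** [vec_set a r e E] sets [a[r][j]] to [E] for [j < e], where [j] is register 4;
    [mat_set a e1 e2 E] sets [a[i][j]] for [i < e1], [j < e2], where moreover
    [i] is register 3. *)
Definition vec_set (a : nat) (r e : iexp) (E : rexp) : cmd :=
  For 4 e (assign (Cell a r (IVar 4)) E).

Definition mat_set (a : nat) (e1 e2 : iexp) (E : rexp) : cmd :=
  For 3 e1 (vec_set a (IVar 3) e2 E).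

(** * Correctness of compiled expressions and of array assignments *)

Section Expressions.
Variable R : realType.
Implicit Types (s : state R) (c : cmd) (e : iexp).

Fixpoint reval (r : nat -> nat) (m : nat -> nat -> nat -> R) (E : rexp) : R :=
  match E with
  | RCell a => m (cell_arr a) (ieval r (cell_row a)) (ieval r (cell_col a))
  | RNat e => (ieval r e)%:R
  | ROp o E1 E2 => rop_eval o (reval r m E1) (reval r m E2)
  | RSum e E1 => \sum_(i < ieval r e) reval (update r 5 i) m E1
  | RPow E1 k => reval r m E1 ^+ k
  end.

Lemma reval_eq b (r r' : nat -> nat) (m m' : nat -> nat -> nat -> R) E :
  rscoped b E -> (forall x, b || (x != 5%N) -> x != 6%N -> r x = r' x) ->
  (forall x, rreads x E -> m x = m' x) -> reval r m E = reval r' m' E.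
Proof.
elim: E b r r' => /=.
- move=> a b r r' /andP[h5 /andP[h6 h6']] hr hm; rewrite hm //.
  congr (m' _ _ _); apply: eq_ieval => x hx; apply: hr.
  + case/orP: h5 => [->//|/andP[h _]]; apply/orP; right.
    by apply: contraNneq h => <-.
  + by apply: contraNneq h6 => <-.
  + case/orP: h5 => [->//|/andP[_ h]]; apply/orP; right.
    by apply: contraNneq h => <-.
  + by apply: contraNneq h6' => <-.
- move=> e b r r' /andP[h5 h6] hr hm; congr (_%:R).
  apply: eq_ieval => x hx; apply: hr.
  + case/orP: h5 => [->//|h]; apply/orP; right.
    by apply: contraNneq h => <-.
  + by apply: contraNneq h6 => <-.
- move=> o E1 IH1 E2 IH2 b r r' /andP[s1 s2] hr hm.
  rewrite (IH1 _ _ _ s1 hr) ?(IH2 _ _ _ s2 hr) // => x hx; apply: hm;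
  by rewrite hx ?orbT.
- move=> e E1 IH b r r' /and4P[nb h5 h6 s1] hr hm.
  have -> : ieval r e = ieval r' e.
    apply: eq_ieval => x hx; apply: hr.
      by apply/orP; right; apply: contraNneq h5 => <-.
    by apply: contraNneq h6 => <-.
  apply: eq_bigr => i _; apply: (IH _ _ _ s1) => // x _ x6.
  by rewrite /update; case: eqP => // /eqP x5; apply: hr => //; rewrite x5 orbT.
- by move=> E1 IH k b r r' s1 hr hm; rewrite (IH _ _ _ s1 hr).
Qed.

Lemma rbelow_reads t E x : rbelow t E -> rreads x E -> (x < t)%N.
Proof.
elim: E => //= [a ? /eqP <- //|o E1 IH1 E2 IH2 /andP[h1 h2] /orP[]]; auto.
Qed.

Lemma rbelowS t E : rbelow t E -> rbelow t.+1 E.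
Proof.
elim: E => //= [a h|o E1 IH1 E2 IH2 /andP[/IH1 -> /IH2 ->]//]; exact: ltnW.
Qed.

(** Arrays from [t] on act as a stack: the value of [E1] waits in [scal t] while [E2] runs from
    [t.+1]. In the body of a sum [b] is true, and the running index in register 5 has to survive. *)
Lemma compileP b t E s : rscoped b E -> rbelow t E ->
  [/\ rmem (run (compile t E) s) t 0%N 0%N = reval (ireg s) (rmem s) E,
      forall a, (a < t)%N -> rmem (run (compile t E) s) a = rmem s a &
      forall x, b || (x != 5%N) -> x != 6%N ->
        ireg (run (compile t E) s) x = ireg s x].
Proof.
elim: E b t s => /=.
- move=> a b t s _ _; rewrite !eqxx; split=> // x h.
  by apply/funext => i; apply/funext => j; rewrite (ltn_eqF h).
- move=> e b t s _ _; rewrite !eqxx; split=> // x h.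
  by apply/funext => i; apply/funext => j; rewrite (ltn_eqF h).
- move=> o E1 IH1 E2 IH2 b t s /andP[s1 s2] /andP[b1 b2].
  have [v1 m1 r1] := IH1 _ _ s s1 b1.
  have [v2 m2 r2] := IH2 _ _ (run (compile t E1) s) s2 (rbelowS b2).
  split.
  + rewrite !eqxx /= /getr /= v2 m2 // v1; congr rop_eval.
    apply: (reval_eq s2); first by move=> x hx x6; rewrite r1.
    by move=> x /(rbelow_reads b2) /m1.
  + move=> a h; apply/funext => i; apply/funext => j; rewrite (ltn_eqF h).
    by rewrite /= m2 1?ltnW // m1.
  + by move=> x hx x6; rewrite r2 // r1.
- move=> e E1 IH b t s /and4P[/negbTE-> h5 h6 s1] b1 /=.
  set s0 := tick _ (setr _ _ s).
  set f := (X in iteri _ X _).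
  have := @iteri_inv _ (fun i u =>
    [/\ rmem u t 0%N 0%N = \sum_(i < i) reval (update (ireg s) 5 i) (rmem s) E1,
      forall a, (a < t)%N -> rmem u a = rmem s a &
      forall x, x != 5%N -> x != 6%N -> ireg u x = ireg s x])
    f (ieval (ireg s) e) (tick (icost e).+1 s0).
  case=> [|i u hi [v m r]|//].
    split=> //=; first by rewrite !eqxx big_ord0.
    move=> a h; apply/funext => i; apply/funext => j; by rewrite (ltn_eqF h).
  rewrite /f /=; set u0 := tick 1 _.
  have [v1 m1 r1] := IH _ _ u0 s1 (rbelowS b1).
  split.
  + rewrite !eqxx /= /getr /= big_ord_recr /= -v m1 // v1 /=; congr (_ + _).
    apply: (reval_eq s1) => [x _ x6|x /(rbelow_reads b1) /m //].
    by rewrite /update /=; case: eqP => // /eqP x5; rewrite r.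
  + move=> a h; apply/funext => k; apply/funext => j; rewrite (ltn_eqF h) /=.
    by rewrite m1 1?ltnW //= m.
  + by move=> x x5 x6; rewrite r1 //= (negbTE x5) r.
- move=> E1 IH k b t s s1 b1 /=.
  have [v1 m1 r1] := IH _ _ s s1 (rbelowS b1).
  set s0 := tick _ (setr _ _ _).
  set f := (X in iteri _ X _).
  have := @iteri_inv _ (fun i u =>
    [/\ rmem u t.+1 0%N 0%N = reval (ireg s) (rmem s) E1,
      rmem u t 0%N 0%N = reval (ireg s) (rmem s) E1 ^+ i,
      forall a, (a < t)%N -> rmem u a = rmem s a &
      forall x, b || (x != 5%N) -> x != 6%N -> ireg u x = ireg s x])
    f k (tick 2 s0).
  case=> [|i u hi [v' v m r]|//].
    split=> //=.
    + by rewrite (gtn_eqF (ltnSn t)).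
    + by rewrite !eqxx.
    + move=> a h; apply/funext => i; apply/funext => j; rewrite (ltn_eqF h) /=.
      by rewrite m1 // ltnW.
  rewrite /f /=; split.
  + by rewrite (gtn_eqF (ltnSn t)).
  + by rewrite !eqxx /= /getr /= v v' exprSr.
  + by move=> a h; apply/funext => l; apply/funext => j; rewrite (ltn_eqF h) /= m.
  + by move=> x x5 x6; rewrite (negbTE x6) r.
Qed.

Lemma assignP a E s : rscoped false E -> rbelow 30 E ->
    cell_free 5 a -> cell_free 6 a -> (cell_arr a < 30)%N ->
  (forall b i j, (b < 30)%N -> rmem (run (assign a E) s) b i j =
      if [&& b == cell_arr a, i == ieval (ireg s) (cell_row a)
           & j == ieval (ireg s) (cell_col a)]
      then reval (ireg s) (rmem s) E else rmem s b i j) /\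
  (forall x, x != 5%N -> x != 6%N -> ireg (run (assign a E) s) x = ireg s x).
Proof.
move=> sE bE /andP[h5 h5'] /andP[h6 h6'] ha /=.
have [v m r] := compileP s sE bE; split; last by move=> x x5 x6; exact: r.
have hi e : ~~ occurs 5 e -> ~~ occurs 6 e ->
    ieval (ireg (run (compile 30 E) s)) e = ieval (ireg s) e.
  move=> o5 o6; apply: eq_ieval => x hx; apply: r.
    by apply: contraNneq o5 => <-.
  by apply: contraNneq o6 => <-.
by move=> b i j hb; rewrite hi // hi // /getr /= v m.
Qed.

(** [E] must not read the array being written, so that every entry is evaluated in the initial
    memory. This is why [deflate] goes through array 4 and [lanczos_poly] through array 13. *)
Definition vec_ok (a : nat) (r : iexp) (E : rexp) : bool :=
  [&& rscoped false E, rbelow 30 E, ~~ rreads a E, (a < 30)%N &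
      [&& ~~ occurs 4 r, ~~ occurs 5 r & ~~ occurs 6 r]].

Lemma vec_set_mem a r e E s : vec_ok a r E ->
  (forall b i j, (b < 30)%N -> rmem (run (vec_set a r e E) s) b i j =
    if [&& b == a, i == ieval (ireg s) r & (j < ieval (ireg s) e)%N]
    then reval (update (ireg s) 4 j) (rmem s) E else rmem s b i j).
Proof.
move=> /and5P[sE bE ra ha /and3P[r4 r5 r6]].
pose f := (fun i (t : state R) => run (assign (Cell a r (IVar 4)) E) (tick 1 (seti 4 i t))).
have := @iteri_inv _ (fun l t =>
  (forall b i j, (b < 30)%N -> rmem t b i j =
    if [&& b == a, i == ieval (ireg s) r & (j < l)%N]
    then reval (update (ireg s) 4 j) (rmem s) E else rmem s b i j) /\
  (forall x, x != 4%N -> x != 5%N -> x != 6%N -> ireg t x = ireg s x))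
  f (ieval (ireg s) e) (tick (icost e).+1 s).
case=> [|l t hl [m r']|h _ b i j hb].
- by split=> // b i j _; rewrite ltn0 !andbF.
- rewrite /f; set t0 := tick 1 _.
  have [] := assignP (a := Cell a r (IVar 4)) t0 sE bE; rewrite /cell_free ?r5 ?r6 //=.
  rewrite -/(run (assign _ _) t0) => m1 i1; split; last first.
    by move=> x x4 x5 x6; rewrite i1 //= (negbTE x4) r'.
  move=> b i j hb; rewrite m1 //=.
  have -> : ieval (update (ireg t) 4 l) r = ieval (ireg s) r.
    apply: eq_ieval => x hx; have x4 : x != 4%N by apply: contraNneq r4 => <-.
    rewrite /update (negbTE x4) r' //; first by apply: contraNneq r5 => <-.
    by apply: contraNneq r6 => <-.
  case: (eqVneq b a) => [->|nb] /=; last by rewrite m // (negbTE nb).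
  case: (eqVneq i) => [->|ni] /=; last by rewrite m // (negbTE ni) !andbF.
  rewrite ltnS leq_eqVlt; case: (eqVneq j l) => [->|nj] /=; last first.
    by rewrite m // !eqxx.
  apply: (reval_eq sE) => [x x5 x6|x hx].
    by rewrite /update; case: eqP => // /eqP x4; rewrite r'.
  have hx30 := rbelow_reads bE hx.
  apply/funext => i'; apply/funext => j'; rewrite m // ifN //.
  by apply: contraNN ra => /andP[/eqP <-].
- by rewrite h.
Qed.

Lemma vec_setP a r e E s i j : vec_ok a r E -> ieval (ireg s) r = i ->
    (j < ieval (ireg s) e)%N ->
  rmem (run (vec_set a r e E) s) a i j = reval (update (ireg s) 4 j) (rmem s) E.
Proof.
move=> ok <- hj; rewrite vec_set_mem //; last by case/and5P: ok.
by rewrite !eqxx hj.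
Qed.

Lemma vec_set_other a r e E s i : vec_ok a r E -> i != ieval (ireg s) r ->
  rmem (run (vec_set a r e E) s) a i = rmem s a i.
Proof.
move=> ok hi; apply/funext => j; rewrite vec_set_mem //; last by case/and5P: ok.
by rewrite (negbTE hi) andbF.
Qed.

Definition mat_ok (a : nat) (e2 : iexp) (E : rexp) : bool :=
  vec_ok a (IVar 3) E &&
  [&& ~~ occurs 3 e2, ~~ occurs 4 e2, ~~ occurs 5 e2 & ~~ occurs 6 e2].

Lemma mat_setP a e1 e2 E s i j : mat_ok a e2 E ->
    (i < ieval (ireg s) e1)%N -> (j < ieval (ireg s) e2)%N ->
  rmem (run (mat_set a e1 e2 E) s) a i j =
  reval (update (update (ireg s) 3 i) 4 j) (rmem s) E.
Proof.
move=> /andP[ok /and4P[o3 o4 o5 o6]] hi hj.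
have /and5P[sE bE ra ha _] := ok.
pose f := (fun i (t : state R) => run (vec_set a (IVar 3) e2 E) (tick 1 (seti 3 i t))).
have := @iteri_inv _ (fun l t =>
  [/\ forall i j, (i < l)%N -> (j < ieval (ireg s) e2)%N -> rmem t a i j =
        reval (update (update (ireg s) 3 i) 4 j) (rmem s) E,
      forall b, (b < 30)%N -> b != a -> rmem t b = rmem s b &
      forall x, x != 3%N -> x != 4%N -> x != 5%N -> x != 6%N -> ireg t x = ireg s x])
  f (ieval (ireg s) e1) (tick (icost e1).+1 s).
case=> [|l t hl [m mf r]|h _ _]; [by []| |exact: h].
rewrite /f; set t0 := tick 1 _; set t1 := run _ t0.
have he2 : ieval (ireg t0) e2 = ieval (ireg s) e2.
  apply: eq_ieval => x hx; have x3 : x != 3%N by apply: contraNneq o3 => <-.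
  rewrite /= (negbTE x3) r //; first by apply: contraNneq o4 => <-.
    by apply: contraNneq o5 => <-.
  by apply: contraNneq o6 => <-.
have vm := vec_set_mem e2 t0 ok; rewrite -/t1 in vm.
have wE (c : nat) x : iwrites x (compile c E) -> (x == 5%N) || (x == 6%N).
  elim: (E) c => //=.
  + by move=> o E1 IH1 E2 IH2 c; rewrite orbF => /orP[/IH1|/IH2].
  + by move=> e E1 IH c /orP[->//|]; rewrite orbF => /IH.
  + by move=> E1 IH k c; rewrite !orbF => /orP[/IH//|->]; rewrite orbT.
split.
- move=> i' j' hi' hj'; rewrite vm // he2 hj' eqxx andbT /=.
  case: eqP => [->|/eqP ne]; last by rewrite m // ltn_neqAle ne -ltnS.
  apply: (reval_eq sE) => [x x5 x6|x hx].
    rewrite /update /=; case: eqP => // /eqP x4; case: eqP => // /eqP x3.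
    by rewrite r.
  rewrite /= mf ?(rbelow_reads bE hx) //.
  by apply: contraNneq ra => <-.
- move=> b hb nb; apply/funext => i'; apply/funext => j'.
  by rewrite vm // (negbTE nb) /= mf.
- move=> x x3 x4 x5 x6; rewrite /t1 run_iframe /=.
    by rewrite (negbTE x3) r.
  rewrite (negbTE x4) /= orbF; apply/negP => /wE.
  by rewrite (negbTE x5) (negbTE x6).
Qed.

Lemma compile_writes t E x : writes x (compile t E) -> (t <= x)%N.
Proof.
elim: E t => //=.
- by move=> a t /eqP->.
- by move=> e t /eqP->.
- by move=> o E1 IH1 E2 IH2 t /orP[/orP[/IH1//|/IH2/ltnW//]|/eqP->].
- by move=> e E1 IH t /orP[/eqP->//|/orP[/IH/ltnW//|/eqP->]].
- by move=> E1 IH k t /orP[/orP[/IH/ltnW//|/eqP->//]|/eqP->].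
Qed.

Lemma vec_set_frame a r e E s b : (b < 30)%N -> b != a ->
  rmem (run (vec_set a r e E) s) b = rmem s b.
Proof.
move=> hb ba; apply: run_frame; rewrite /= negb_or eq_sym ba andbT.
by apply/negP => /compile_writes; rewrite leqNgt hb.
Qed.

End Expressions.

(** * The moment inequality *)

Section Inequality.
Variable R : realType.

(** Weighted AM-GM. The inductive step adds [a] times the previous case to the rearrangement
    inequality [a ^ (m+1) b + a b ^ (m+1) <= a ^ (m+2) + b ^ (m+2)]. *)
Lemma young_pow (a b : R) m : 0 <= a -> 0 <= b ->
  m.+1%:R * (a ^+ m * b) <= m%:R * a ^+ m.+1 + b ^+ m.+1.
Proof.
move=> a0 b0; elim: m => [|m IH]; first by rewrite !expr1 expr0 mul0r add0r !mul1r.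
have h : 0 <= (a ^+ m.+1 - b ^+ m.+1) * (a - b).
  case: (leP a b) => ab.
    by rewrite mulr_le0 // subr_le0 // lerXn2r.
  by rewrite mulr_ge0 // subr_ge0 ?lerXn2r // ltW.
move: h (ler_wpM2l a0 IH); rewrite -[m.+2%:R]natr1 -![m.+1%:R]natr1 !exprS; lra.
Qed.

(** By Lagrange's identity: the defect is half the sum of the squares of all 2 by 2 minors. *)
Lemma sum_CauchySchwarz (I : finType) (f g : I -> R) :
  (\sum_i f i * g i) ^+ 2 <= (\sum_i f i ^+ 2) * (\sum_i g i ^+ 2).
Proof.
have : 0 <= \sum_i \sum_j (f i * g j - f j * g i) ^+ 2.
  by apply: sumr_ge0 => i _; apply: sumr_ge0 => j _; apply: sqr_ge0.
have -> : \sum_i \sum_j (f i * g j - f j * g i) ^+ 2 =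
   2 * ((\sum_i f i ^+ 2) * (\sum_i g i ^+ 2) - (\sum_i f i * g i) ^+ 2).
  pose A := (\sum_i f i ^+ 2) * (\sum_i g i ^+ 2).
  pose B := (\sum_i g i ^+ 2) * (\sum_i f i ^+ 2).
  pose C := (\sum_i f i * g i) * (\sum_i f i * g i).
  have -> : 2 * ((\sum_i f i ^+ 2) * (\sum_i g i ^+ 2) - (\sum_i f i * g i) ^+ 2) =
    A + B - C - C by rewrite /A /B /C; ring.
  rewrite /A /B /C !big_distrlr /= -big_split /= -!sumrB; apply: eq_bigr => i _.
  by rewrite -big_split /= -!sumrB; apply: eq_bigr => j _; ring.
by rewrite pmulr_rge0 // subr_ge0.
Qed.

Definition dot d (u v : 'cV[R]_d) : R := \sum_(j < d) u j 0 * v j 0.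

Lemma dotE d (u v : 'cV[R]_d) : u^T *m v = (dot u v)%:M.
Proof.
apply/matrixP => i j; rewrite !ord1 !mxE eqxx mulr1n.
by apply: eq_bigr => k _; rewrite mxE.
Qed.

Lemma dotC d (u v : 'cV[R]_d) : dot u v = dot v u.
Proof. by apply: eq_bigr => j _; rewrite mulrC. Qed.

Lemma dotDl d (u1 u2 v : 'cV[R]_d) : dot (u1 + u2) v = dot u1 v + dot u2 v.
Proof. by rewrite -big_split; apply: eq_bigr => j _; rewrite mxE mulrDl. Qed.

Lemma dotZl d k (u v : 'cV[R]_d) : dot (k *: u) v = k * dot u v.
Proof. by rewrite mulr_sumr; apply: eq_bigr => j _; rewrite mxE mulrA. Qed.

Lemma dotNl d (u v : 'cV[R]_d) : dot (- u) v = - dot u v.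
Proof. by rewrite -scaleN1r dotZl mulN1r. Qed.

Lemma dot0l d (v : 'cV[R]_d) : dot 0 v = 0.
Proof. by apply: big1 => j _; rewrite mxE mul0r. Qed.

Lemma dotDr d (u v1 v2 : 'cV[R]_d) : dot u (v1 + v2) = dot u v1 + dot u v2.
Proof. by rewrite dotC dotDl !(dotC u). Qed.

Lemma dotZr d k (u v : 'cV[R]_d) : dot u (k *: v) = k * dot u v.
Proof. by rewrite dotC dotZl dotC. Qed.

Lemma dotNr d (u v : 'cV[R]_d) : dot u (- v) = - dot u v.
Proof. by rewrite dotC dotNl dotC. Qed.

Lemma dot0r d (v : 'cV[R]_d) : dot v 0 = 0.
Proof. by rewrite dotC dot0l. Qed.

Lemma dot_mulmx n d (A : 'M[R]_(n, d)) u v : dot (A *m u) v = dot u (A^T *m v).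
Proof.
apply/eqP; rewrite -subr_eq0; apply/eqP.
have := dotE (A *m u) v; rewrite trmx_mul -mulmxA dotE => /matrixP/(_ 0 0).
by rewrite !mxE eqxx !mulr1n => ->; rewrite subrr.
Qed.

Lemma dot_ge0 d (v : 'cV[R]_d) : 0 <= dot v v.
Proof. by apply: sumr_ge0 => j _; rewrite -expr2 sqr_ge0. Qed.

Lemma dot_eq0 d (v : 'cV[R]_d) : (dot v v == 0) = (v == 0).
Proof.
apply/eqP/eqP => [h|->]; last exact: dot0l.
apply/matrixP => i j; rewrite !ord1 mxE; apply/eqP.
have := psumr_eq0P (fun j _ => sqr_ge0 (v j 0)) (_ : _ = 0) => /(_ predT).
rewrite -sqrf_eq0 => -> //; rewrite -[RHS]h; apply: eq_bigr => k _; exact: expr2.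
Qed.

Lemma dot_gt0 d (v : 'cV[R]_d) : v != 0 -> 0 < dot v v.
Proof. by rewrite lt_def dot_ge0 andbT dot_eq0. Qed.

Lemma dot_CauchySchwarz d (u v : 'cV[R]_d) : dot u v ^+ 2 <= dot u u * dot v v.
Proof.
apply: le_trans (sum_CauchySchwarz _ _) _.
by rewrite le_eqVlt; apply/orP; left; apply/eqP; congr (_ * _);
  apply: eq_bigr => i _; rewrite expr2.
Qed.

Lemma norm2E d (v : 'cV[R]_d) : norm2 v = Num.sqrt (dot v v).
Proof. by congr Num.sqrt; apply: eq_bigr => j _; rewrite expr2. Qed.

Lemma norm2_eq1 d (v : 'cV[R]_d) : norm2 v = 1 <-> dot v v = 1.
Proof.
rewrite norm2E; split=> [h|->]; last exact: sqrtr1.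
by rewrite -[LHS]sqr_sqrtr ?dot_ge0 // h expr1n.
Qed.

(** The coordinates of the [m]-fold tensor power of [x]; the functions [phi] are the
    multi-indices. *)
Definition tensor d m (x : 'cV[R]_d) (phi : {ffun 'I_m -> 'I_d}) : R :=
  \prod_t x (phi t) 0.

Lemma dot_tensor d m (x y : 'cV[R]_d) :
  \sum_(phi : {ffun 'I_m -> 'I_d}) tensor x phi * tensor y phi = dot x y ^+ m.
Proof.
under eq_bigr do rewrite -big_split /=.
rewrite -(bigA_distr_bigA (fun (_ : 'I_m) j => x j 0 * y j 0)) /=.
by rewrite prodr_const card_ord.
Qed.

(** Pairs of multi-indices are matrix positions: this is the Frobenius product of the rank-one
    matrices built from the tensor powers of [x] and [y]. *)
Lemma dot_tensor2 d m (x y : 'cV[R]_d) :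
  \sum_(p : {ffun 'I_m -> 'I_d} * {ffun 'I_m -> 'I_d})
     (tensor x p.1 * tensor x p.2) * (tensor y p.1 * tensor y p.2) =
  dot x y ^+ (2 * m).
Proof.
rewrite mulnC exprM expr2 -dot_tensor big_distrlr /= pair_big /=.
by apply: eq_bigr => p _; rewrite mulrACA.
Qed.

Lemma tensor_bound n d m (x : 'I_n -> 'cV[R]_d) (v : 'cV[R]_d) (B : R) :
  dot v v = 1 -> 0 <= B ->
  (forall i, \sum_j dot (x i) (x j) ^+ (2 * m) * dot (x j) v ^+ 2
             <= B * dot (x i) (x i) ^+ m) ->
  \sum_i dot (x i) v ^+ (2 * m + 2) <= B * Num.sqrt (d%:R ^+ m).
Proof.
move=> v1 B0 hB.
pose I := {ffun 'I_m -> 'I_d}; pose c i := dot (x i) v ^+ 2.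
have c0 i : 0 <= c i by apply: sqr_ge0.
pose N (p : I * I) := \sum_i c i * (tensor (x i) p.1 * tensor (x i) p.2).
pose S := \sum_p N p ^+ 2.
have SE : S = \sum_i c i * \sum_j dot (x i) (x j) ^+ (2 * m) * c j.
  transitivity (\sum_i \sum_j \sum_(p : I * I) (c i * (tensor (x i) p.1 * tensor (x i) p.2)) *
      (c j * (tensor (x j) p.1 * tensor (x j) p.2))).
    rewrite /S; under eq_bigr do rewrite /N expr2 big_distrlr /=.
    by rewrite exchange_big; apply: eq_bigr => i _; rewrite exchange_big.
  apply: eq_bigr => i _; rewrite mulr_sumr; apply: eq_bigr => j _.
  by rewrite -dot_tensor2 mulr_suml mulr_sumr; apply: eq_bigr => p _; ring.
pose tr := \sum_i c i * dot (x i) (x i) ^+ m.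
have S_tr : S <= B * tr.
  rewrite SE mulr_sumr; apply: ler_sum => i _; rewrite mulrCA.
  exact: ler_wpM2l.
have tr0 : 0 <= tr.
  by apply: sumr_ge0 => i _; rewrite mulr_ge0 // exprn_ge0 // dot_ge0.
(* The trace pairs [N] with the identity, whose squared Frobenius norm is [d ^ m]; the diagonal
   entries contribute only a part of [S]. *)
have tr_S : tr ^+ 2 <= d%:R ^+ m * S.
  have -> : tr = \sum_(p : I) N (p, p) * 1.
    under [RHS]eq_bigr do rewrite mulr1 /N /=.
    by rewrite exchange_big; apply: eq_bigr => i _ /=; rewrite -mulr_sumr dot_tensor.
  apply: le_trans (sum_CauchySchwarz _ _) _; rewrite mulrC.
  have -> : \sum_(p : I) (1 : R) ^+ 2 = d%:R ^+ m.
    under eq_bigr do rewrite expr1n.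
    by rewrite sumr_const card_ffun !card_ord natrX.
  apply: ler_wpM2l; first by rewrite exprn_ge0.
  rewrite /S -(pair_big xpredT xpredT (fun p1 p2 => N (p1, p2) ^+ 2)) /=.
  apply: ler_sum => p _; rewrite (bigD1 p) //= lerDl.
  by apply: sumr_ge0 => p' _; apply: sqr_ge0.
(* The sum is the Frobenius product of [N] with the rank-one matrix of [v], which has norm 1 because
   [v] is a unit vector. *)
have F_S : (\sum_i dot (x i) v ^+ (2 * m + 2)) ^+ 2 <= S.
  have -> : \sum_i dot (x i) v ^+ (2 * m + 2) =
     \sum_(p : I * I) N p * (tensor v p.1 * tensor v p.2).
    under [RHS]eq_bigr do rewrite mulr_suml.
    rewrite exchange_big; apply: eq_bigr => i _.
    rewrite exprD -dot_tensor2 mulr_suml.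
    by apply: eq_bigr => p _; rewrite /c; ring.
  apply: le_trans (sum_CauchySchwarz _ _) _.
  have -> : \sum_(p : I * I) (tensor v p.1 * tensor v p.2) ^+ 2 = 1.
    transitivity (dot v v ^+ (2 * m)); last by rewrite v1 expr1n.
    by rewrite -dot_tensor2; apply: eq_bigr => p _; rewrite expr2.
  by rewrite mulr1.
set F := \sum_i _ in F_S *; set D := _ ^+ m in tr_S *.
have D0 : 0 <= D by rewrite exprn_ge0.
have S0 : 0 <= S by apply: sumr_ge0 => p _; apply: sqr_ge0.
(* The two bounds feed each other: [S ^ 2 <= B ^ 2 tr ^ 2 <= B ^ 2 D S], and a nonzero [S]
   cancels. *)
have SB : S <= B ^+ 2 * D.
  have [S_eq0|Sn0] := eqVneq S 0; first by rewrite S_eq0 mulr_ge0 ?sqr_ge0.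
  have Sgt0 : 0 < S by rewrite lt_neqAle eq_sym Sn0.
  rewrite -(ler_pM2r Sgt0) -mulrA.
  apply: le_trans (_ : (B * tr) ^+ 2 <= _).
    by rewrite -expr2 lerXn2r ?nnegrE // mulr_ge0.
  by rewrite exprMn ler_wpM2l ?sqr_ge0.
have F0 : 0 <= F by apply: sumr_ge0 => i _; rewrite -mulnSr exprM exprn_ge0 // sqr_ge0.
rewrite -(ler_pXn2r (n := 2)) ?nnegrE ?mulr_ge0 ?sqrtr_ge0 //.
by rewrite exprMn sqr_sqrtr //; apply: le_trans F_S SB.
Qed.

(* Hoelder for the conjugate pair (q / (q - 2), q / 2), through Young. *)
Lemma mixed_moment_bound n d m (x : 'I_n -> 'cV[R]_d) (a u : 'cV[R]_d) (B : R) :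
  \sum_j dot (x j) a ^+ (2 * m + 2) <= B ->
  \sum_j dot (x j) u ^+ (2 * m + 2) <= B ->
  \sum_j dot a (x j) ^+ (2 * m) * dot (x j) u ^+ 2 <= B.
Proof.
move=> ha hu.
have m0 : (0 : R) < m.+1%:R by [].
rewrite -(ler_pM2l m0) mulr_sumr.
apply: le_trans (_ : \sum_j (m%:R * dot (x j) a ^+ (2 * m + 2) +
   dot (x j) u ^+ (2 * m + 2)) <= _).
  apply: ler_sum => j _; rewrite (dotC a) -mulnSr !exprM.
  exact: young_pow (sqr_ge0 _) (sqr_ge0 _).
rewrite big_split /= -mulr_sumr -natr1 mulrDl mul1r lerD //.
by rewrite ler_wpM2l.
Qed.

End Inequality.

(** * Eigenvalues, projections and tridiagonal matrices *)

(** Only two entries of the last row survive, and the minor of the off-diagonal one is expanded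
    along its last column. Indexing the entries by [nat] makes the remaining minors leading blocks
    of the same shape. *)
Lemma det_tridiagonal (K : comNzRingType) (t : nat -> nat -> K) k :
  (forall i j, (i.+1 < j)%N || (j.+1 < i)%N -> t i j = 0) ->
  \det (\matrix_(i < k.+2, j < k.+2) t i j) =
  t k.+1 k.+1 * \det (\matrix_(i < k.+1, j < k.+1) t i j)
  - t k.+1 k * t k k.+1 * \det (\matrix_(i < k, j < k) t i j).
Proof.
move=> t0; rewrite (expand_det_row _ ord_max) big_ord_recr big_ord_recr /=.
rewrite big1 ?add0r => [|i _]; last first.
  by rewrite mxE t0 ?mul0r //=; apply/orP; right; rewrite !ltnS ltn_ord.
rewrite !mxE /= addrC; congr (_ + _).
  rewrite /cofactor /= -signr_odd addnn odd_double mul1r.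
  congr (_ * \det _); apply/matrixP => i j; rewrite !mxE /= /bump.
  by have hi := ltn_ord i; have hj := ltn_ord j; congr t; lia.
rewrite /cofactor /= -signr_odd addSn /= addnn odd_double /= expr1 mulN1r mulrN.
rewrite -mulrA; congr (- (_ * _)).
rewrite (expand_det_col _ ord_max) big_ord_recr /=.
rewrite big1 ?add0r => [|i _]; last first.
  by rewrite !mxE t0 ?mul0r //= /bump; have := ltn_ord i; lia.
rewrite !mxE /=; congr (_ * _); first by congr t; rewrite /bump; lia.
rewrite /cofactor /= -signr_odd addnn odd_double mul1r.
congr (\det _); apply/matrixP => i j; rewrite !mxE /= /bump.
have hi := ltn_ord i; have hj := ltn_ord j.
congr t; lia.
Qed.

Section LinearAlgebra.
Variable R : realType.

Lemma mulmx_bound n d (A : 'M[R]_(n, d)) : exists2 K : R, 0 <= K &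
  forall v : 'cV_d, dot (A *m v) (A *m v) <= K * dot v v.
Proof.
exists (\sum_i \sum_j A i j ^+ 2).
  by apply: sumr_ge0 => i _; apply: sumr_ge0 => j _; apply: sqr_ge0.
move=> v; rewrite mulr_suml; apply: ler_sum => i _.
rewrite -expr2 mxE; apply: le_trans (sum_CauchySchwarz _ _) _.
apply: ler_wpM2l; first by apply: sumr_ge0 => j _; apply: sqr_ge0.
by rewrite le_eqVlt (eq_bigr (fun j => v j 0 * v j 0)) ?eqxx.
Qed.

Lemma psd_CauchySchwarz d (N : 'M[R]_d) (u v : 'cV[R]_d) : N^T = N ->
  (forall v : 'cV[R]_d, 0 <= dot v (N *m v)) ->
  dot u (N *m v) ^+ 2 <= dot u (N *m u) * dot v (N *m v).
Proof.
move=> sN psd.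
have sym x y : dot x (N *m y) = dot y (N *m x) by rewrite dotC dot_mulmx sN.
set a := dot u (N *m u); set b := dot u (N *m v); set c := dot v (N *m v).
have q s t : 0 <= s ^+ 2 * a + 2 * s * t * b + t ^+ 2 * c.
  have := psd (s *: u + t *: v).
  rewrite mulmxDr -!scalemxAr !dotDl !dotDr !dotZl !dotZr (sym v u) -/a -/b -/c.
  by congr (_ <= _); ring.
have a0 : 0 <= a by exact: psd.
have [a_eq0|an0] := eqVneq a 0.
  (* With [a = 0] the form at this point equals [- b ^ 2 (c + 2)], so [b] vanishes. *)
  have := q (- (c + 1)) (b); have := q 1 0; have c0 : 0 <= c by exact: psd.
  rewrite a_eq0; nra.
have a_gt0 : 0 < a by rewrite lt_def an0.
have := q (- b) a.
have -> : (- b) ^+ 2 * a + 2 * (- b) * a * b + a ^+ 2 * c = a * (a * c - b ^+ 2) by ring.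
by rewrite pmulr_rge0 // subr_ge0.
Qed.

Lemma eigenvalue_singular d (M : 'M[R]_d) a :
  root (char_poly M) a = (M - a%:M \notin unitmx).
Proof.
by rewrite -eigenvalue_root_char /eigenvalue /eigenspace kermx_eq0 row_free_unit.
Qed.

(** The supremum [mu] of the Rayleigh quotients is an eigenvalue, without first showing that it is
    attained: if [N = mu - M] were invertible, its nonnegative form would be bounded below by a
    positive multiple of [|v| ^ 2], and the quotients would stay away from [mu]. *)
Lemma rayleigh_max d (M : 'M[R]_d) : (0 < d)%N -> M^T = M ->
  exists2 mu : R, root (char_poly M) mu &
    forall v : 'cV[R]_d, dot v (M *m v) <= mu * dot v v.
Proof.
case: d M => // d M _ sM.
pose E := [set dot v (M *m v) | v in [set v : 'cV[R]_d.+1 | dot v v = 1]]%classic.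
have [K K0 hK] := mulmx_bound M.
have supE : has_sup E.
  split.
    exists (dot (delta_mx 0 0) (M *m delta_mx 0 0)), (delta_mx 0 0) => //=.
    rewrite /dot (bigD1 0) //= big1 => [|i ni]; first by rewrite !mxE eqxx mulr1 addr0.
    by rewrite !mxE (negbTE ni) mul0r.
  exists (K + 1) => _ [v /= v1 <-].
  have := dot_CauchySchwarz v (M *m v); have := hK v; rewrite v1; nra.
pose mu := sup E.
have le_mu v : dot v (M *m v) <= mu * dot v v.
  have [->|vn0] := eqVneq v 0; first by rewrite mulmx0 !dot0r mulr0.
  have v_gt0 := dot_gt0 vn0.
  pose r := Num.sqrt (dot v v).
  have r2 : r ^+ 2 = dot v v by rewrite sqr_sqrtr // ltW.
  have rn0 : r != 0 by rewrite -sqrf_eq0 r2 dot_eq0.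
  have : dot (r^-1 *: v) (M *m (r^-1 *: v)) <= mu.
    apply: sup_upper_bound => //; exists (r^-1 *: v) => //=.
    rewrite dotZl dotZr -r2; field; exact: rn0.
  rewrite -scalemxAr dotZl dotZr mulrA -expr2 exprVn r2 mulrC.
  by rewrite ler_pdivrMr.
exists mu => //; rewrite eigenvalue_singular; apply/negP => unitM.
pose N := mu%:M - M.
have unitN : N \in unitmx by rewrite /N -opprB -scaleN1r unitmxZ ?unitrN1.
have sN : N^T = N by rewrite linearB /= tr_scalar_mx sM.
have NE v : dot v (N *m v) = mu * dot v v - dot v (M *m v).
  by rewrite mulmxBl mul_scalar_mx dotDr dotNr dotZr.
have psd v : 0 <= dot v (N *m v) by rewrite NE subr_ge0.
have [K1 K10 hK1] := mulmx_bound N.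
have [K2 K20 hK2] := mulmx_bound (invmx N).
(* Cauchy-Schwarz for the form of [N], applied to [N v] and [v]. As [K1] bounds squared norms,
   [K1 + 1] stands in for its square root. *)
have lowN v : dot (N *m v) (N *m v) <= (K1 + 1) * dot v (N *m v).
  set w := N *m v.
  have h1 : dot w w ^+ 2 <= dot w (N *m w) * dot v w.
    exact: (psd_CauchySchwarz w v sN psd).
  have h2 : dot w (N *m w) <= (K1 + 1) * dot w w.
    have w0 := dot_ge0 w; have K11 : 0 <= K1 + 1 by lra.
    rewrite -(ler_pXn2r (n := 2)) ?nnegrE ?mulr_ge0 //.
    apply: le_trans (dot_CauchySchwarz _ _) _.
    apply: le_trans (ler_wpM2l w0 (hK1 w)) _.
    rewrite mulrCA -expr2 exprMn ler_wpM2r ?sqr_ge0 //; nra.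
  have [w0|wn0] := eqVneq w 0; first by rewrite w0 !dot0r mulr0.
  have w_gt0 := dot_gt0 wn0.
  have vw0 : 0 <= dot v w by exact: psd.
  rewrite -(ler_pM2r w_gt0) -expr2; apply: le_trans h1 _.
  by rewrite mulrAC; apply: ler_wpM2r.
have low v : dot v v <= K2 * (K1 + 1) * dot v (N *m v).
  have := hK2 (N *m v); rewrite mulKmx // => /le_trans; apply.
  by rewrite -mulrA ler_wpM2l.
(* The added 1 makes [k] positive. A unit vector with quotient above [mu - 1/k] then contradicts
   [low]. *)
pose k := K2 * (K1 + 1) + 1.
have k_gt0 : 0 < k by rewrite /k; nra.
have kV_gt0 : 0 < k^-1 by rewrite invr_gt0.
have [_ [v /= v1 <-] hv] := sup_adherent kV_gt0 supE.
have := low v; rewrite NE v1 mulr1 => h.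
have := le_mu v; rewrite v1 mulr1 => h'.
have : (mu - dot v (M *m v)) * k < 1.
  by rewrite -ltr_pdivlMr // mul1r; move: hv; rewrite -/mu; lra.
rewrite /k; nra.
Qed.

(** Induction on the size, dividing out a known root. This makes the supremum in [largest_root] an
    actual root. *)
Lemma ex_max_root (p : {poly R}) a : p != 0 -> root p a ->
  exists2 b, root p b & forall x, root p x -> x <= b.
Proof.
have [n] := ubnP (size p); elim: n => // n IH in p a *.
rewrite ltnS => sp pn0 pa; have /factor_theorem[r pE] := pa.
have rn0 : r != 0 by apply: contraNneq pn0 => r0; rewrite pE r0 mul0r.
have rp x : root p x = root r x || (x == a) by rewrite pE rootM root_XsubC.
have [[c rc]|nr] := pselect (exists c, root r c); last first.
  exists a => // x; rewrite rp => /orP[rx|/eqP->//]; by case: nr; exists x.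
have [|b rb hb] := IH r c _ rn0 rc.
  by apply: leq_trans sp; rewrite pE size_Mmonic ?monicXsubC // size_XsubC addn2.
exists (Num.max a b); first by rewrite rp; case: leP => _; rewrite ?rb ?eqxx ?orbT.
by move=> x; rewrite rp le_max => /orP[/hb->|/eqP->]; rewrite ?lexx ?orbT.
Qed.

Lemma largest_rootE (p : {poly R}) b : root p b ->
  (forall x, root p x -> x <= b) -> largest_root p = b.
Proof.
move=> pb hb; apply/eqP; rewrite eq_le; apply/andP; split.
  by apply: ge_sup; [exists b|move=> x; exact: hb].
by apply: sup_upper_bound => //; split; exists b => // x; exact: hb.
Qed.

Lemma largest_root_rayleigh d (M : 'M[R]_d) : (0 < d)%N -> M^T = M ->
  root (char_poly M) (largest_root (char_poly M)) /\
  forall v : 'cV[R]_d, dot v (M *m v) <= largest_root (char_poly M) * dot v v.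
Proof.
move=> d0 sM; have [mu rmu hmu] := rayleigh_max d0 sM.
have [b rb hb] := ex_max_root (monic_neq0 (char_poly_monic M)) rmu.
rewrite (largest_rootE rb hb); split=> // v; apply: le_trans (hmu v) _.
by rewrite ler_wpM2r ?dot_ge0 ?hb.
Qed.

(** The coefficients are written as the programs [normalize] and [root_of] produce them, with
    indicators in place of case distinctions. *)
Lemma largest_root_Xn_sub m (c : R) : (0 < m)%N -> 0 <= c ->
  largest_root (\poly_(i < m.+1) ((i == m)%:R - (i == 0)%:R * c)) = c `^ m%:R^-1.
Proof.
move=> m0 c0; set p := \poly_(_ < _) _.
have pE : p = 'X^m - c%:P.
  apply/polyP => i; rewrite coef_poly coefB coefXn coefC ltnS.
  case: leqP => [_|h]; first by congr (_ - _); case: eqP; rewrite ?mul1r ?mul0r.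
  by rewrite (gtn_eqF h) (gtn_eqF (leq_ltn_trans _ h)) // subrr.
have rpE x : root p x = (x ^+ m == c).
  by rewrite pE /root !hornerE subr_eq0.
have cm : (c `^ m%:R^-1) ^+ m = c.
  by rewrite -powR_mulrn ?powR_ge0 // -powRrM mulVf ?powRr1 // pnatr_eq0 -lt0n.
apply: largest_rootE; first by rewrite rpE cm.
move=> x; rewrite rpE => /eqP xm; rewrite leNgt; apply/negP => h.
have : (c `^ m%:R^-1) ^+ m < x ^+ m.
  by rewrite ltrXn2r ?powR_ge0 // -lt0n.
by rewrite cm xm ltxx.
Qed.

Definition projection d (Q : 'M[R]_d) := Q^T = Q /\ Q *m Q = Q.

(* For r = 0 the junk value 0^-1 = 0 makes this the identity. *)
Definition deflated d (Q : 'M[R]_d) (r : 'cV[R]_d) : 'M[R]_d :=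
  Q - (dot r r)^-1 *: (r *m r^T).

Lemma deflated_mul d (Q : 'M[R]_d) (r x : 'cV[R]_d) :
  deflated Q r *m x = Q *m x - ((dot r r)^-1 * dot r x) *: r.
Proof.
by rewrite mulmxBl -scalemxAl -mulmxA dotE mul_mx_scalar scalerA.
Qed.

Lemma projection_deflated d (Q : 'M[R]_d) (r : 'cV[R]_d) :
  projection Q -> Q *m r = r -> projection (deflated Q r).
Proof.
move=> [sQ iQ] Qr; split.
  by rewrite linearB /= linearZ /= trmx_mul trmxK sQ.
have rQ : r^T *m Q = r^T by rewrite -[Q]sQ -trmx_mul Qr.
rewrite {2}/deflated mulmxBr -scalemxAr mulmxA deflated_mul Qr.
have [r0|rn0] := eqVneq r 0.
  by rewrite /deflated r0 mul0mx scaler0 subr0 scaler0 subr0 iQ mul0mx scaler0 subr0.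
rewrite mulVf ?dot_eq0 // scale1r subrr mul0mx scaler0 subr0.
by rewrite /deflated mulmxBl -scalemxAl -mulmxA rQ iQ.
Qed.

Lemma deflated_self d (Q : 'M[R]_d) (r : 'cV[R]_d) :
  Q *m r = r -> deflated Q r *m r = 0.
Proof.
move=> Qr; rewrite deflated_mul Qr; have [->|rn0] := eqVneq r 0.
  by rewrite scaler0 subr0.
by rewrite mulVf ?dot_eq0 // scale1r subrr.
Qed.

Lemma projection_dot d (Q : 'M[R]_d) (r x : 'cV[R]_d) :
  projection Q -> Q *m r = r -> dot r x = dot r (Q *m x).
Proof. by move=> [sQ _] Qr; rewrite -[in LHS]Qr dot_mulmx sQ. Qed.

Lemma deflated_ker d (Q : 'M[R]_d) (r x : 'cV[R]_d) :
  projection Q -> Q *m r = r -> Q *m x = 0 -> deflated Q r *m x = 0.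
Proof.
move=> pQ Qr Qx; rewrite deflated_mul Qx (projection_dot x pQ Qr) Qx dot0r.
by rewrite mulr0 scale0r subr0.
Qed.

Lemma deflated_fix d (Q : 'M[R]_d) (r x : 'cV[R]_d) :
  dot r x = 0 -> Q *m x = x -> deflated Q r *m x = x.
Proof. by move=> rx Qx; rewrite deflated_mul Qx rx mulr0 scale0r subr0. Qed.

(** The trace plays the role of the rank: it drops by one with each Lanczos vector, so it is still
    positive before round [d] and a restart always finds a fresh vector. *)
Lemma trace_deflated d (Q : 'M[R]_d) (r : 'cV[R]_d) : r != 0 ->
  \tr (deflated Q r) = \tr Q - 1.
Proof.
move=> rn0; rewrite linearB /= linearZ /= mxtrace_mulC dotE mxtrace_scalar.
by rewrite mulr1n mulVf // dot_eq0.
Qed.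

Lemma trace_gt0_pivot d (Q : 'M[R]_d) : 0 < \tr Q -> exists j, 0 < Q j j.
Proof.
move=> tQ; apply/existsP; apply: contraLR tQ => /existsPn h.
by rewrite -leNgt sumr_le0 // => i _; rewrite leNgt h.
Qed.

(** From [Q = Q Q^T] a diagonal entry is the squared norm of its row, so nonpositive diagonal
    entries force [Q = 0]. *)
Lemma projection_pivot d (Q : 'M[R]_d) : projection Q -> Q != 0 ->
  exists j, 0 < Q j j.
Proof.
move=> [sQ iQ] /eqP Qn0; apply/existsP; apply/contra_notT: Qn0 => /existsPn h.
have row0 i : \sum_j Q i j ^+ 2 = 0.
  apply/eqP; rewrite eq_le sumr_ge0 ?andbT => [|j _]; last exact: sqr_ge0.
  rewrite (_ : \sum_j _ = Q i i) ?leNgt //.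
  rewrite -[in RHS]iQ mxE; apply: eq_bigr => j _.
  by rewrite expr2 -[in X in _ = _ * X]sQ mxE.
apply/matrixP => i j; rewrite mxE; apply/eqP; rewrite -sqrf_eq0; apply/eqP.
exact: (psumr_eq0P (fun j _ => sqr_ge0 (Q i j)) (row0 i)).
Qed.

(** The pair [(p_(k-1), p_k)] of consecutive polynomials, with the convention that [p_(-1)] is
    zero. *)
Fixpoint three_term (al be : nat -> R) (k : nat) : {poly R} * {poly R} :=
  if k is k'.+1 then
    let p := three_term al be k' in
    (p.2, ('X - (al k')%:P) * p.2 - (be k')%:P * p.1)
  else (0, 1).

(** Orthogonally to [w 0], ..., [w i], the vector [M w_i] is [w i.+1] or, when the
    process is restarted with a fresh vector [w i.+1], zero. *)
Definition lanczos_step d (M : 'M[R]_d) (w : nat -> 'cV[R]_d) (i : nat) :=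
  exists b : bool, forall x : 'cV[R]_d,
    (forall l, (l <= i)%N -> dot (w l) x = 0) ->
    dot x (M *m w i) = b%:R * dot x (w i.+1).

(** In the orthogonal basis [w] the matrix [M] becomes a tridiagonal [T]: a Lanczos step kills the
    entries below the subdiagonal, and symmetry those above the superdiagonal. *)
Lemma char_poly_lanczos d (M : 'M[R]_d) (w : nat -> 'cV[R]_d) (be : nat -> R) :
  M^T = M -> (forall i, (i < d)%N -> w i != 0) ->
  (forall i j, (i < j < d)%N -> dot (w i) (w j) = 0) ->
  (forall i, (i.+1 < d)%N -> lanczos_step M w i) ->
  (forall i, (i.+1 < d)%N ->
     be i.+1 = dot (w i) (M *m w i.+1) / dot (w i) (w i)) ->
  char_poly M =
  (three_term (fun i => dot (w i) (M *m w i) / dot (w i) (w i)) be d).2.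
Proof.
move=> sM wn0 wo wl hbe.
have wo2 i j : (i < d)%N -> (j < d)%N -> i != j -> dot (w i) (w j) = 0.
  move=> hi hj; rewrite neq_ltn => /orP[h|h]; first by rewrite wo ?h.
  by rewrite dotC wo ?h.
have symM x y : dot x (M *m y) = dot y (M *m x) by rewrite dotC dot_mulmx sM.
(* Extended by zero, because [det_tridiagonal] requires the entries off the band to vanish at all
   indices. *)
pose t i j := if (i < d)%N && (j < d)%N then
  dot (w i) (M *m w j) / dot (w j) (w j) else 0.
have up i j : (i.+1 < j)%N -> (j < d)%N -> dot (w j) (M *m w i) = 0.
  move=> ij jd; have id1 := ltn_trans ij jd; have [b ->] := wl i id1.
    by rewrite wo2 ?mulr0 // gtn_eqF.
  move=> l li; rewrite wo2 ?ltn_eqF //; last exact: leq_ltn_trans li (ltnW ij).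
  exact: leq_ltn_trans li (ltnW id1).
have t0 i j : (i.+1 < j)%N || (j.+1 < i)%N -> t i j = 0.
  rewrite /t; case: andP => // -[hi hj] /orP[] h.
    by rewrite symM up // mul0r.
  by rewrite up // mul0r.
pose W := \matrix_(i < d, j < d) w i j 0.
pose T := \matrix_(i < d, j < d) t i j.
have WE (i : 'I_d) (A : 'M[R]_d) (j : 'I_d) : (W *m A *m W^T) i j = dot (w i) (A *m w j).
  rewrite -mulmxA mxE; apply: eq_bigr => k _; rewrite !mxE; congr (_ * _).
  by apply: eq_bigr => l _; rewrite !mxE.
have WW (i j : 'I_d) : (W *m W^T) i j = dot (w i) (w j).
  by have := WE i 1%:M j; rewrite mulmx1 mul1mx.
have unitW : W \in unitmx.
  rewrite unitmxE unitfE; apply/negP => /eqP dW.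
  have : \det (W *m W^T) = 0 by rewrite det_mulmx dW mul0r.
  have -> : W *m W^T = diag_mx (\row_i dot (w i) (w i)).
    apply/matrixP => i j; rewrite WW !mxE; case: eqP => [->//|/eqP ne].
    by rewrite mulr0n wo2.
  rewrite det_diag => /eqP/prodf_eq0[i _]; rewrite mxE dot_eq0.
  by rewrite (negbTE (wn0 _ (ltn_ord i))).
(* After multiplication by the invertible [W^T] both sides have the entries [<w_i, M w_j>]. *)
have sim : W *m M = T *m W.
  apply: (can_inj (mulmxK (_ : W^T \in unitmx))); first by rewrite unitmx_tr.
  rewrite -mulmxA; apply/matrixP => i j; rewrite mulmxA WE -mulmxA mxE (bigD1 j) //=.
  rewrite WW big1 ?addr0 => [|k kj]; last by rewrite WW wo2 ?mulr0.
  by rewrite mxE /t !ltn_ord /= divfK // dot_eq0 wn0.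
have -> : char_poly M = char_poly T.
  rewrite /char_poly; apply: (@mulfI _ (\det (map_mx polyC W))).
    by rewrite det_map_mx polyC_eq0 -unitfE -unitmxE.
  rewrite -det_mulmx [RHS]mulrC -det_mulmx; congr (\det _).
  rewrite /char_poly_mx mulmxBr mulmxBl -!map_mxM sim; congr (_ - _).
  by rewrite scalar_mxC.
pose tX i j : {poly R} := 'X *+ (i == j) - (t i j)%:P.
have tX0 i j : (i.+1 < j)%N || (j.+1 < i)%N -> tX i j = 0.
  move=> h; rewrite /tX t0 // subr0; case: eqP => // ij.
  by move: h; rewrite ij !ltnNge leqnSn.
pose D k := \det (\matrix_(i < k, j < k) tX i j).
set p := three_term _ _.
have tXd k : (k < d)%N -> tX k k = 'X - (dot (w k) (M *m w k) / dot (w k) (w k))%:P.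
  by move=> hk; rewrite /tX /t hk eqxx.
(* With [<w_(k+1), M w_k> = b |w_(k+1)| ^ 2], the product of the two off-diagonal entries is
   [b ^ 2 |w_(k+1)| ^ 2 / |w_k| ^ 2], and [b ^ 2 = b] for a boolean. *)
have off k : (k.+1 < d)%N -> tX k.+1 k * tX k k.+1 = (be k.+1)%:P.
  move=> hk; rewrite /tX (gtn_eqF (ltnSn k)) (ltn_eqF (ltnSn k)) !sub0r mulrNN.
  rewrite -polyCM hbe //; congr (_%:P); rewrite /t hk (ltnW hk) /=.
  have [b hb] := wl k hk.
  have hk1 : dot (w k.+1) (M *m w k) = b%:R * dot (w k.+1) (w k.+1).
    by apply: hb => l lk; rewrite wo // ltnS lk.
  rewrite (symM (w k)) hk1 mulfK ?dot_eq0 ?wn0 //.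
  by case: (b); rewrite ?mulr1 // !mul0r.
have DE k : (k <= d)%N -> D k = (p k).2 /\ ((k < d)%N -> D k.+1 = (p k.+1).2).
  elim: k => [_|k IH hk].
    have D0 : D 0 = 1 by rewrite /D det_mx00.
    split=> // d0; rewrite /D det_mx11 mxE tXd //= mulr1 mulr0 subr0 //.
  have [IH1 IH2] := IH (ltnW hk); split; first exact: IH2.
  move=> hk1; rewrite {1}/D det_tridiagonal // -/(D k) -/(D k.+1) IH1 (IH2 hk).
  by rewrite tXd // off // [in RHS]/p /=.
have [<- _] := DE d (leqnn d).
congr (\det _); apply/matrixP => i j; rewrite !mxE /tX; congr (_ *+ _ - _).
Qed.

End LinearAlgebra.

(** * Elementary subroutines *)

(** Memory layout.  Arrays: 0 input, 1 output, 2 squared norm, 3 projection matrix,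
    4 copy of it, 5 zero, 6 pivot column, 7 residual, 8 its squared norm,
    9 Lanczos vectors [w] (row [k.+1] holds [w_k], row 0 is zero), 10 their images
    [M w], 11 and 12 recurrence coefficients, 13 scratch polynomial, 14 polynomials
    (row [k.+1] holds the one of degree [k], row 0 is zero), 15 largest root,
    16 [M - lam], 17 weights, 18 [M], 19 and 25 polynomials [X^k - c], 20 and 26
    their roots, 21 [X v], 22 and 24 best value and vector, 23 current value.
    Registers: 3 and 4 assignment loops, 5 sums, 6 powers, 7 to 9 outer loops. *)

Arguments run : simpl never.
Arguments update _ _ _ _ /.

Notation "c1 ;; c2" := (Seq c1 c2) (at level 100, right associativity).
Notation rc a i j := (RCell (Cell a i j)).
Notation nX := (IVar 0).
Notation dX := (IVar 1).

(* Truncated subtraction turns the tests [e1 = e2] and [0 < e] into 0 or 1. *)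
Definition RDelta (e1 e2 : iexp) : rexp :=
  RNat (ISub (INum 1) (IAdd (ISub e1 e2) (ISub e2 e1))).

Definition RPos (e : iexp) : rexp := RNat (ISub (INum 1) (ISub (INum 1) e)).

(* [x / x] is 0 for [x = 0] and 1 otherwise. *)
Definition RIsZero (E : rexp) : rexp := ROp Rsub (RNat (INum 1)) (ROp Rdiv E E).

Definition set_scal (a : nat) (E : rexp) : cmd := vec_set a (INum 0) (INum 1) E.

Definition RDot (a : nat) (r : iexp) (b : nat) (r' : iexp) : rexp :=
  RSum dX (ROp Rmul (rc a r (IVar 5)) (rc b r' (IVar 5))).

Definition deflate (a : nat) (r : iexp) : cmd :=
  set_scal 2 (RDot a r a r) ;;
  mat_set 4 dX dX
    (ROp Rsub (rc 3 (IVar 3) (IVar 4))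
       (ROp Rmul (ROp Rdiv (RNat (INum 1)) (rc 2 (INum 0) (INum 0)))
                 (ROp Rmul (rc a r (IVar 3)) (rc a r (IVar 4))))) ;;
  mat_set 3 dX dX (rc 4 (IVar 3) (IVar 4)).

(** Each positive diagonal entry overwrites array 6 with its column, so the last one wins. A
    positive diagonal entry certifies that the column is nonzero. *)
Definition pick_pivot : cmd :=
  set_scal 5 (RNat (INum 0)) ;;
  For 9 dX (IfR (Cell 3 (IVar 9) (IVar 9)) (scal 5) Skip
                (vec_set 6 (INum 0) dX (rc 3 (IVar 4) (IVar 9)))).

Definition normalize (a : nat) (r t : iexp) : cmd :=
  set_scal 2 (RDot a r a r) ;;
  vec_set 19 (INum 0) (INum 3)
    (ROp Rsub (RDelta (IVar 4) (INum 2))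
       (ROp Rmul (RDelta (IVar 4) (INum 0)) (rc 2 (INum 0) (INum 0)))) ;;
  RootR (scal 20) 19 (INum 0) (INum 2) ;;
  vec_set 1 t dX
    (ROp Radd (ROp Rdiv (rc a r (IVar 4)) (rc 20 (INum 0) (INum 0)))
       (ROp Rmul (RDelta (IVar 4) (INum 0)) (RIsZero (rc 2 (INum 0) (INum 0))))).

(** * Correctness of deflation, pivot choice and normalization *)

Section Blocks.
Variables (R : realType) (d : nat).
Implicit Types s : state R.

Definition colm s (a r : nat) : 'cV[R]_d := \col_j rmem s a r j.
Definition matm s (a : nat) : 'M[R]_d := \matrix_(i, j) rmem s a i j.

Lemma run_seq c1 c2 s : run (c1 ;; c2) s = run c2 (run c1 s).
Proof. by []. Qed.

Lemma run_root x y r e s i k : ieval (ireg s) r = i -> ieval (ireg s) e = k ->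
  rmem (run (RootR (scal x) y r e) s) x 0%N 0%N =
  largest_root (\poly_(j < k.+1) rmem s y i j).
Proof. by move=> <- <-; rewrite /run /= eqxx. Qed.

Lemma run_for x e c s : run (For x e c) s =
  iteri (ieval (ireg s) e) (fun i t => run c (tick 1 (seti x i t)))
        (tick (icost e).+1 s).
Proof. by []. Qed.

Lemma for_inv (I : nat -> state R -> Prop) x e c s k :
  ieval (ireg s) e = k -> I 0%N (tick (icost e).+1 s) ->
  (forall i t, (i < k)%N -> I i t -> I i.+1 (run c (tick 1 (seti x i t)))) ->
  I k (run (For x e c) s).
Proof. by move=> ek I0 IS; rewrite run_for ek; apply: iteri_inv. Qed.

Lemma run_if a b c1 c2 s : run (IfR a b c1 c2) s =
  run (if getr a s <= getr b s then c1 else c2) (tick (ccost a + ccost b).+1 s).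
Proof. by rewrite {1}/run -/run; case: ifP. Qed.

Lemma ieval_update r x k e : ~~ occurs x e -> ieval (update r x k) e = ieval r e.
Proof.
move=> h; apply: eq_ieval => y hy; rewrite /update; case: eqP => // yx.
by rewrite -yx hy in h.
Qed.

Lemma delta_nat a b : (1 - ((a - b) + (b - a)) = (a == b))%N.
Proof. by case: (eqVneq a b) => h /=; lia. Qed.

Lemma set_scalP a E s : vec_ok a (INum 0) E ->
  rmem (run (set_scal a E) s) a 0%N 0%N = reval (update (ireg s) 4 0) (rmem s) E.
Proof. by move=> ok; apply: vec_setP. Qed.

Lemma colm_vec_set a r E s i (v : 'cV[R]_d) : vec_ok a r E ->
  ieval (ireg s) r = i -> ireg s 1 = d ->
  (forall j : 'I_d, reval (update (ireg s) 4 j) (rmem s) E = v j 0) ->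
  colm (run (vec_set a r dX E) s) a i = v.
Proof.
move=> ok hr hd hv; apply/matrixP => j k; rewrite ord1 mxE vec_setP //.
by rewrite /= hd.
Qed.

Lemma matm_mat_set a E s (Q : 'M[R]_d) : mat_ok a dX E -> ireg s 1 = d ->
  (forall i j : 'I_d, reval (update (update (ireg s) 3 i) 4 j) (rmem s) E = Q i j) ->
  matm (run (mat_set a dX dX E) s) a = Q.
Proof.
by move=> ok hd hQ; apply/matrixP => i j; rewrite mxE mat_setP //= hd.
Qed.

Lemma reval_dot r m a x b y : ~~ occurs 5 x -> ~~ occurs 5 y -> r 1%N = d ->
  reval r m (RDot a x b y) =
  dot (\col_(j < d) m a (ieval r x) j : 'cV[R]_d) (\col_j m b (ieval r y) j).
Proof.
move=> hx hy hd /=; rewrite hd; apply: eq_bigr => j _.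
by rewrite !mxE !ieval_update.
Qed.

Definition outer_iexp (r : iexp) : bool :=
  [&& ~~ occurs 3 r, ~~ occurs 4 r, ~~ occurs 5 r & ~~ occurs 6 r].

Lemma deflateP a r s : ireg s 1 = d -> (a < 30)%N -> a \notin [:: 2; 3; 4]%N ->
  outer_iexp r ->
  let v := colm s a (ieval (ireg s) r) in
  matm (run (deflate a r) s) 3 = deflated (matm s 3) v /\
  rmem (run (deflate a r) s) 2 0%N 0%N = dot v v.
Proof.
move=> hd ha; rewrite !inE !negb_or => /and3P[a2 a3 a4] /and4P[r3 r4 r5 r6] v.
rewrite /deflate !run_seq.
set c1 := set_scal _ _; set c2 := mat_set 4 _ _ _.
set s1 := run c1 s.
have s1d : ireg s1 1 = d by rewrite -hd; apply: run_iframe.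
have N1 : rmem s1 2 0%N 0%N = dot v v.
  rewrite set_scalP; last by rewrite /vec_ok /= /cell_free /= r6 ha (negbTE a2).
  by rewrite reval_dot ?ieval_update // hd.
have s1a : rmem s1 a = rmem s a by apply: vec_set_frame.
have s13 : rmem s1 3 = rmem s 3 by apply: run_frame.
have s1r : ieval (ireg s1) r = ieval (ireg s) r.
  apply: eq_ieval => x hx; apply: run_iframe => /=.
  have n4 : x != 4%N by apply: contraNneq r4 => <-.
  have n5 : x != 5%N by apply: contraNneq r5 => <-.
  by rewrite (negbTE n4) (negbTE n5).
clearbody s1.
set s2 := run c2 s1.
have s2d : ireg s2 1 = d by rewrite -s1d; apply: run_iframe.
split; last by rewrite run_frame // /s2 run_frame.
apply: matm_mat_set => // i j.
rewrite /s2 [LHS]/= mat_setP /= ?s1d //; last first.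
  by rewrite /mat_ok /vec_ok /= /cell_free /= r5 r6 ha (negbTE a4).
by rewrite !ieval_update // !mxE big_ord1 !mxE N1 s1a s13 s1r mul1r.
Qed.

Lemma pick_pivotP s : ireg s 1 = d -> (exists j, 0 < matm s 3 j j) ->
  exists2 j, 0 < matm s 3 j j & colm (run pick_pivot s) 6 0 = col j (matm s 3).
Proof.
move=> hd [j0 hj0]; rewrite /pick_pivot run_seq.
set s1 := run (set_scal _ _) s.
have s1d : ireg s1 1 = d by rewrite -hd; apply: run_iframe.
have Z1 : rmem s1 5 0%N 0%N = 0 by rewrite set_scalP.
have s13 : rmem s1 3 = rmem s 3 by apply: run_frame.
clearbody s1; set c := IfR _ _ _ _.
have := @for_inv (fun i (t : state R) =>
  [/\ ireg t 1 = d, rmem t 3 = rmem s 3, rmem t 5 0%N 0%N = 0 &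
    forall j : 'I_d, (j < i)%N -> 0 < matm s 3 j j ->
    exists2 j, 0 < matm s 3 j j & colm t 6 0 = col j (matm s 3)]) 9 dX c s1 d s1d.
case=> [|i t hi [td t3 t5 h]|_ _ _ h]; [by split | | by apply: (h j0)].
set t1 := tick 1 _.
have r1 : ireg (run c t1) 1 = d by rewrite -td; apply: (@run_iframe _ 1 c t1).
have r3 : rmem (run c t1) 3 = rmem s 3 by rewrite -t3; apply: (@run_frame _ 3 c t1).
have r5 : rmem (run c t1) 5%N 0%N 0%N = 0.
  by rewrite -t5; rewrite (@run_frame _ 5 c t1).
split=> // j; rewrite ltnS leq_eqVlt /c run_if.
rewrite /getr /= t3 t5 => hj pj; case: leP => hp.
  case/orP: hj => [/eqP ji|ji]; last exact: h pj.
  by move: pj; rewrite mxE ji => /(le_lt_trans hp); rewrite ltxx.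
exists (Ordinal hi); first by rewrite mxE.
apply: colm_vec_set => //= k.
by rewrite !mxE /= t3.
Qed.

(** A zero vector is sent to the first basis vector, so that the list holds unit vectors only;
    [normalizedK] still holds there because the scalar is 0. *)
Definition normalized (v : 'cV[R]_d) : 'cV[R]_d :=
  if v == 0 then \col_j (j == 0 :> nat)%:R else (Num.sqrt (dot v v))^-1 *: v.

Lemma dot_normalized v : (0 < d)%N -> dot (normalized v) (normalized v) = 1.
Proof.
move=> d0; rewrite /normalized; have [_|vn0] := eqVneq.
  rewrite /dot (bigD1 (Ordinal d0)) //= !mxE mulr1 big1 ?addr0 // => j nj.
  rewrite !mxE; case: eqP => [j0|]; last by rewrite mul0r.
  by move: nj; rewrite -val_eqE /= j0.
rewrite dotZl dotZr mulrA -expr2 exprVn sqr_sqrtr ?dot_ge0 // mulVf //.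
by rewrite dot_eq0.
Qed.

Lemma normalizedK v : v = Num.sqrt (dot v v) *: normalized v.
Proof.
rewrite /normalized; case: eqVneq => [->|vn0].
  by rewrite dot0r sqrtr0 scale0r.
rewrite scalerA divff ?scale1r // sqrtr_eq0 -ltNge; exact: dot_gt0.
Qed.

Lemma normalizeP a r t s : ireg s 1 = d -> (a < 30)%N ->
  a \notin [:: 1; 2; 19; 20]%N -> outer_iexp r -> outer_iexp t ->
  colm (run (normalize a r t) s) 1 (ieval (ireg s) t) =
    normalized (colm s a (ieval (ireg s) r)) /\
  forall i, i != ieval (ireg s) t ->
    rmem (run (normalize a r t) s) 1 i = rmem s 1 i.
Proof.
move=> hd ha; rewrite !inE !negb_or => /and4P[a1 a2 a19 a20] /and4P[r3 r4 r5 r6].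
move=> /and4P[t3 t4 t5 t6].
set v := colm s _ _.
rewrite /normalize !run_seq.
set c1 := set_scal _ _; set c2 := vec_set 19 _ _ _; set c3 := RootR _ _ _ _.
set s1 := run c1 s.
have s1d : ireg s1 1 = d by rewrite -hd; apply: run_iframe.
have s1r x : x != 4%N -> x != 5%N -> ireg s1 x = ireg s x.
  by move=> n4 n5; apply: run_iframe; rewrite /= (negbTE n4) (negbTE n5).
have N1 : rmem s1 2 0%N 0%N = dot v v.
  rewrite set_scalP; last by rewrite /vec_ok /= /cell_free /= r6 ha (negbTE a2).
  by rewrite reval_dot ?ieval_update // hd.
have s1a : rmem s1 a = rmem s a by apply: vec_set_frame.
have s11 : rmem s1 1 = rmem s 1 by apply: vec_set_frame.
clearbody s1.
set s2 := run c2 s1; set s3 := run c3 s2.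
have s3d : ireg s3 1 = d.
  by rewrite -s1d; transitivity (ireg s2 1); apply: run_iframe.
have s3r e : outer_iexp e -> ieval (ireg s3) e = ieval (ireg s) e.
  move=> /and4P[e3 e4 e5 e6]; apply: eq_ieval => x hx.
  have n4 : x != 4%N by apply: contraNneq e4 => <-.
  have n5 : x != 5%N by apply: contraNneq e5 => <-.
  rewrite -s1r //; transitivity (ireg s2 x); apply: run_iframe => //.
  by rewrite /= (negbTE n4).
have N3 : rmem s3 2 0%N 0%N = dot v v.
  by rewrite -N1; transitivity (rmem s2 2 0%N 0%N); rewrite run_frame.
have S3 : rmem s3 20 0%N 0%N = Num.sqrt (dot v v).
  rewrite /s3 (@run_root _ _ _ _ _ 0 2) // -powR12_sqrt ?dot_ge0 //.
  rewrite -(@largest_root_Xn_sub R 2) ?dot_ge0 //.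
  congr largest_root; apply/polyP => i; rewrite !coef_poly; case: ltnP => // hi.
  by rewrite vec_setP //= N1 !delta_nat.
have s3a : rmem s3 a = rmem s a.
  rewrite -s1a; transitivity (rmem s2 a); last exact: vec_set_frame.
  by apply: run_frame; rewrite /= eq_sym.
have s31 : rmem s3 1 = rmem s 1.
  by rewrite -s11; transitivity (rmem s2 1); apply: run_frame.
clearbody s3.
have ok : vec_ok 1 t (ROp Radd (ROp Rdiv (rc a r (IVar 4)) (rc 20 (INum 0) (INum 0)))
       (ROp Rmul (RDelta (IVar 4) (INum 0)) (RIsZero (rc 2 (INum 0) (INum 0))))).
  by rewrite /vec_ok /= /cell_free /= r5 r6 t4 t5 t6 ha (negbTE a1).
split; last first.
  by move=> i hi; rewrite vec_set_other ?s31 // s3r //; apply/and4P.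
apply: colm_vec_set => // [|j /=]; first by apply: s3r; apply/and4P.
rewrite N3 S3 delta_nat s3a ieval_update // s3r; last exact/and4P.
rewrite /normalized; have [v0|vn0] := eqVneq v 0.
  have -> : rmem s a (ieval (ireg s) r) j = 0.
    by move/matrixP: v0 => /(_ j 0); rewrite !mxE.
  by rewrite v0 dot0r mul0r add0r mul0r subr0 mulr1 mxE.
rewrite divff ?dot_eq0 // subrr mulr0 addr0 !mxE mulrC //.
Qed.

End Blocks.

(** * The Lanczos process *)

Notation kS := (IAdd (IVar 8) (INum 1)).

(** The residual [Q M w] is taken with the full projection, which costs O(d^2) per round and handles
    restarts without a branch: when the residual is zero, its indicator adds the pivot column. Row 0
    of array 10 is zero, so the first round is such a restart. *)
Definition lanczos_vector : cmd :=
  vec_set 7 (INum 0) dX (RDot 3 (IVar 4) 10 (IVar 8)) ;;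
  set_scal 8 (RDot 7 (INum 0) 7 (INum 0)) ;;
  pick_pivot ;;
  vec_set 9 kS dX
    (ROp Radd (rc 7 (INum 0) (IVar 4))
      (ROp Rmul (RIsZero (rc 8 (INum 0) (INum 0))) (rc 6 (INum 0) (IVar 4)))) ;;
  vec_set 10 kS dX (RDot 18 (IVar 4) 9 kS) ;;
  deflate 9 kS.

(** One step of the three-term recurrence on coefficients. [RPos] suppresses the shifted coefficient
    at index 0, where truncated subtraction would read coefficient 0 again. *)
Definition lanczos_poly : cmd :=
  set_scal 11 (ROp Rdiv (RDot 9 kS 10 kS) (RDot 9 kS 9 kS)) ;;
  set_scal 12 (ROp Rdiv (RDot 9 (IVar 8) 10 kS) (RDot 9 (IVar 8) 9 (IVar 8))) ;;
  vec_set 13 (INum 0) (IAdd dX (INum 1))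
    (ROp Rsub
      (ROp Rsub (ROp Rmul (RPos (IVar 4)) (rc 14 kS (ISub (IVar 4) (INum 1))))
                (ROp Rmul (rc 11 (INum 0) (INum 0)) (rc 14 kS (IVar 4))))
      (ROp Rmul (rc 12 (INum 0) (INum 0)) (rc 14 (IVar 8) (IVar 4)))) ;;
  vec_set 14 (IAdd (IVar 8) (INum 2)) (IAdd dX (INum 1)) (rc 13 (INum 0) (IVar 4)).

Definition lanczos_init : cmd :=
  mat_set 3 dX dX (RDelta (IVar 3) (IVar 4)) ;;
  vec_set 9 (INum 0) dX (RNat (INum 0)) ;;
  vec_set 10 (INum 0) dX (RNat (INum 0)) ;;
  vec_set 14 (INum 0) (IAdd dX (INum 1)) (RNat (INum 0)) ;;
  vec_set 14 (INum 1) (IAdd dX (INum 1)) (RDelta (IVar 4) (INum 0)).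

Definition lanczos : cmd :=
  lanczos_init ;; For 8 dX (lanczos_vector ;; lanczos_poly).

Section Lanczos.
Variables (R : realType) (d : nat).
Implicit Types s t : state R.

Local Notation colm s a r := (@colm R d s a%N r%N).
Local Notation matm s a := (@matm R d s a%N).

Definition same (l : seq nat) s t := forall x, x \in l -> rmem t x = rmem s x.

Lemma same_run l c s : all (fun x => ~~ writes x c) l -> same l s (run c s).
Proof. by move=> /allP h x /h; apply: run_frame. Qed.

Lemma same_trans l s t u : same l s t -> same l t u -> same l s u.
Proof. by move=> st tu x hx; rewrite tu // st. Qed.

Lemma same_colm l s t x i : same l s t -> x \in l -> colm t x i = colm s x i.
Proof. by move=> st /st h; apply/matrixP => j k; rewrite !mxE h. Qed.

Lemma same_matm l s t x : same l s t -> x \in l -> matm t x = matm s x.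
Proof. by move=> st /st h; apply/matrixP => j k; rewrite !mxE h. Qed.

Lemma reval_mulmx s a b y (j : 'I_d) k : ireg s 1 = d -> ~~ occurs 4 y ->
  ~~ occurs 5 y -> ieval (ireg s) y = k ->
  reval (update (ireg s) 4 j) (rmem s) (RDot a (IVar 4) b y) =
  (matm s a *m colm s b k) j 0.
Proof.
move=> hd y4 y5 hk; rewrite (@reval_dot R d) //= ieval_update // hk mxE.
by apply: eq_bigr => l _; rewrite !mxE.
Qed.

Lemma lanczos_vectorP s k (Q M : 'M[R]_d) y :
  ireg s 1 = d -> ireg s 8 = k -> matm s 3 = Q -> matm s 18 = M ->
  colm s 10 k = y -> (exists j, 0 < Q j j) ->
  let t := run lanczos_vector s in
  exists w : 'cV[R]_d,
    [/\ w = Q *m y /\ w != 0 \/ Q *m y = 0 /\ exists2 j, 0 < Q j j & w = col j Q,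
        [/\ colm t 9 k.+1 = w & forall i, i != k.+1 -> rmem t 9 i = rmem s 9 i],
        [/\ colm t 10 k.+1 = M *m w & forall i, i != k.+1 -> rmem t 10 i = rmem s 10 i] &
        matm t 3 = deflated Q w].
Proof.
move=> hd hk hQ hM hy piv; rewrite /= /lanczos_vector 5!run_seq.
set s1 := run _ s.
have d1 : ireg s1 1 = d by rewrite -hd; apply: run_iframe.
have k1 : ireg s1 8 = k by rewrite -hk; apply: run_iframe.
have F1 : same [:: 3; 9; 10; 18]%N s s1 by apply: same_run.
have r1 : colm s1 7 0 = Q *m y.
  apply: colm_vec_set => // j.
  by rewrite (@reval_mulmx _ _ _ _ _ k) // hQ hy.
clearbody s1; set s2 := run _ s1.
have d2 : ireg s2 1 = d by rewrite -d1; apply: run_iframe.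
have k2 : ireg s2 8 = k by rewrite -k1; apply: run_iframe.
have G2 : same [:: 3; 7; 9; 10; 18]%N s1 s2 by apply: same_run.
have r2 : colm s2 7 0 = Q *m y by rewrite -r1; apply: same_colm G2 _.
have n2 : rmem s2 8 0%N 0%N = dot (Q *m y) (Q *m y).
  by rewrite set_scalP // (@reval_dot R d) // -r1.
have F2 : same [:: 3; 9; 10; 18]%N s s2.
  by move=> x hx; rewrite G2 ?F1 //; move: hx; rewrite !inE => /or4P[]->; rewrite ?orbT.
clearbody s2; clear s1 d1 k1 F1 r1 G2; set s3 := run _ s2.
have d3 : ireg s3 1 = d by rewrite -d2; apply: run_iframe.
have k3 : ireg s3 8 = k by rewrite -k2; apply: run_iframe.
have G3 : same [:: 3; 7; 8; 9; 10; 18]%N s2 s3 by apply: same_run.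
have r3 : colm s3 7 0 = Q *m y by rewrite -r2; apply: same_colm G3 _.
have n3 : rmem s3 8 0%N 0%N = dot (Q *m y) (Q *m y) by rewrite G3.
have Q2 : matm s2 3 = Q by rewrite -hQ; apply: same_matm F2 _.
have := @pick_pivotP R d s2 d2; rewrite Q2 => /(_ piv)[j jpos]; rewrite -/s3 => p3.
have F3 : same [:: 3; 9; 10; 18]%N s s3.
  by move=> x hx; rewrite G3 ?F2 //; move: hx; rewrite !inE => /or4P[]->; rewrite ?orbT.
clearbody s3; clear s2 d2 k2 F2 r2 n2 G3 Q2.
pose w := Q *m y + (1 - dot (Q *m y) (Q *m y) / dot (Q *m y) (Q *m y)) *: col j Q.
set s4 := run _ s3.
have d4 : ireg s4 1 = d by rewrite -d3; apply: run_iframe.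
have k4 : ireg s4 8 = k by rewrite -k3; apply: run_iframe.
have G4 : same [:: 3; 10; 18]%N s3 s4 by apply: same_run.
have w4 : colm s4 9 k.+1 = w.
  apply: colm_vec_set => //= [|l]; first by rewrite k3 addn1.
  have -> : rmem s3 6 0 l = col j Q l 0 by rewrite -p3 mxE.
  have -> : rmem s3 7 0 l = (Q *m y) l 0 by rewrite -r3 mxE.
  by rewrite n3 [in RHS]mxE [X in _ = _ + X]mxE.
have o4 i : i != k.+1 -> rmem s4 9 i = rmem s 9 i.
  by move=> hi; rewrite vec_set_other ?F3 //= k3 addn1.
have F4 : same [:: 3; 10; 18]%N s s4.
  by move=> x hx; rewrite G4 ?F3 //; move: hx; rewrite !inE => /or3P[]->; rewrite ?orbT.
clearbody s4; clear s3 d3 k3 F3 r3 n3 G4 p3.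
set s5 := run _ s4.
have d5 : ireg s5 1 = d by rewrite -d4; apply: run_iframe.
have k5 : ireg s5 8 = k by rewrite -k4; apply: run_iframe.
have G5 : same [:: 3; 9; 18]%N s4 s5 by apply: same_run.
have y5 : colm s5 10 k.+1 = M *m w.
  apply: colm_vec_set => // [|l]; first by rewrite /= k4 addn1.
  rewrite (@reval_mulmx _ _ _ _ _ k.+1) //= ?k4 ?addn1 // w4.
  by rewrite (same_matm F4) // hM.
have o5 i : i != k.+1 -> rmem s5 10 i = rmem s 10 i.
  by move=> hi; rewrite vec_set_other ?F4 //= k4 addn1.
have w5 : colm s5 9 k.+1 = w by rewrite -w4; apply: same_colm G5 _.
have Q5 : matm s5 3 = Q by rewrite (same_matm G5) // (same_matm F4).
have o5' i : i != k.+1 -> rmem s5 9 i = rmem s 9 i by move=> hi; rewrite G5 ?o4.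
clearbody s5; clear s4 d4 k4 w4 o4 F4 G5.
have [D6 _] := @deflateP R d 9 (IAdd (IVar 8) (INum 1)) s5 d5 isT isT isT.
have G6 : same [:: 9; 10]%N s5 (run (deflate 9 (IAdd (IVar 8) (INum 1))) s5).
  by apply: same_run.
exists w; split.
- rewrite /w; have [r0|rn0] := eqVneq (Q *m y) 0.
    right; split=> //; exists j => //.
    by rewrite r0 dot0r mul0r subr0 scale1r add0r.
  by left; rewrite divff ?dot_eq0 // subrr scale0r addr0.
- by split; [rewrite (same_colm _ G6)|move=> i hi; rewrite G6 ?o5'].
- by split; [rewrite (same_colm _ G6)|move=> i hi; rewrite G6 ?o5].
- by rewrite D6 Q5 /= k5 addn1 w5.
Qed.

Lemma reval_op r m o E1 E2 :
  reval r m (ROp o E1 E2) = rop_eval o (reval r m E1) (reval r m E2) :> R.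
Proof. by []. Qed.

Lemma lanczos_polyP s k (w0 w y : 'cV[R]_d) :
  ireg s 1 = d -> ireg s 8 = k -> colm s 9 k = w0 ->
  colm s 9 k.+1 = w -> colm s 10 k.+1 = y ->
  let t := run lanczos_poly s in
  (forall j, (j <= d)%N -> rmem t 14 k.+2 j =
     (if j is j'.+1 then rmem s 14 k.+1 j' else 0)
     - dot w y / dot w w * rmem s 14 k.+1 j
     - dot w0 y / dot w0 w0 * rmem s 14 k j) /\
  forall i, i != k.+2 -> rmem t 14 i = rmem s 14 i.
Proof.
move=> hd hk hw0 hw hy; rewrite /= /lanczos_poly !run_seq.
set s1 := run _ s.
have d1 : ireg s1 1 = d by rewrite -hd; apply: run_iframe.
have k1 : ireg s1 8 = k by rewrite -hk; apply: run_iframe.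
have F1 : same [:: 9; 10; 14]%N s s1 by apply: same_run.
have a1 : rmem s1 11 0%N 0%N = dot w y / dot w w.
  rewrite set_scalP // reval_op /rop_eval !(@reval_dot R d) //= hk addn1.
  by rewrite -/(colm s 9 k.+1) -/(colm s 10 k.+1) hw hy.
clearbody s1; set s2 := run _ s1.
have d2 : ireg s2 1 = d by rewrite -d1; apply: run_iframe.
have k2 : ireg s2 8 = k by rewrite -k1; apply: run_iframe.
have G2 : same [:: 11; 14]%N s1 s2 by apply: same_run.
have b2 : rmem s2 12 0%N 0%N = dot w0 y / dot w0 w0.
  rewrite set_scalP // reval_op /rop_eval !(@reval_dot R d) //= k1 addn1.
  rewrite -/(colm s1 9 k) -/(colm s1 10 k.+1) (same_colm _ F1) // (same_colm _ F1) //.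
  by rewrite hw0 hy.
have a2 : rmem s2 11 0%N 0%N = dot w y / dot w w by rewrite G2.
have p2 : rmem s2 14 = rmem s 14 by rewrite G2 ?F1.
clearbody s2; clear s1 d1 k1 F1 a1 G2; set s3 := run _ s2.
have d3 : ireg s3 1 = d by rewrite -d2; apply: run_iframe.
have k3 : ireg s3 8 = k by rewrite -k2; apply: run_iframe.
have p3 : rmem s3 14 = rmem s 14 by rewrite -p2; apply: run_frame.
have v3 j : (j <= d)%N -> rmem s3 13 0%N j =
     (if j is j'.+1 then rmem s 14 k.+1 j' else 0)
     - dot w y / dot w w * rmem s 14 k.+1 j
     - dot w0 y / dot w0 w0 * rmem s 14 k j.
  move=> hj; rewrite vec_setP //=; last by rewrite d2 addn1 ltnS.
  rewrite a2 b2 p2 k2 addn1; congr (_ - _ - _).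
  by case: j {hj} => [|j]; rewrite ?mul0r // subSS sub0n mul1r subn1.
clearbody s3; clear s2 d2 k2 a2 b2 p2.
split=> [j hj|i hi].
  by rewrite vec_setP //= ?k3 ?addn2 ?v3 // d3 addn1 ltnS.
by rewrite vec_set_other ?p3 //= k3 addn2.
Qed.

(** [W i.+1] is [w_i], following the memory layout. The second and fourth clauses make [Q] the
    orthogonal projection onto the complement of the vectors found so far. *)
Definition lanczos_inv (M : 'M[R]_d) (k : nat) (Q : 'M[R]_d) (W : nat -> 'cV[R]_d) :=
  [/\ projection Q /\ \tr Q = d%:R - k%:R,
      forall i, (i < k)%N -> W i.+1 != 0 /\ Q *m W i.+1 = 0,
      forall i j, (i < j < k)%N -> dot (W i.+1) (W j.+1) = 0,
      forall x, (forall i, (i < k)%N -> dot (W i.+1) x = 0) -> Q *m x = x &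
      forall i, (i.+1 < k)%N -> lanczos_step M (fun i => W i.+1) i].

Lemma lanczos_inv_step M k Q W W' y w : lanczos_inv M k Q W ->
  y = (if k is k'.+1 then M *m W k else 0) ->
  w = Q *m y /\ w != 0 \/ Q *m y = 0 /\ (exists2 j, 0 < Q j j & w = col j Q) ->
  (forall i, (i <= k)%N -> W' i = W i) -> W' k.+1 = w ->
  lanczos_inv M k.+1 (deflated Q w) W'.
Proof.
move=> [[pQ trQ] W0 Wo Wf Wl] yE wE W'E W'w.
have [sQ iQ] := pQ.
have Qw : Q *m w = w.
  case: wE => [[-> _]|[_ [j _ ->]]]; first by rewrite mulmxA iQ.
  by rewrite colE mulmxA iQ.
have wn0 : w != 0.
  case: wE => [[]//|[_ [j jpos ->]]]; apply/eqP => /matrixP/(_ j 0).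
  by rewrite !mxE => j0; rewrite j0 ltxx in jpos.
have wW i : (i < k)%N -> dot w (W i.+1) = 0.
  by move=> ik; rewrite (projection_dot _ pQ Qw) (W0 i ik).2 dot0r.
split.
- split; first exact: projection_deflated.
  by rewrite trace_deflated // trQ -natr1 opprD addrA.
- move=> i; rewrite ltnS leq_eqVlt => /orP[/eqP->|ik].
    by rewrite W'w deflated_self.
  by rewrite W'E //; have [h1 h2] := W0 i ik; rewrite deflated_ker.
- move=> i j /andP[ij]; rewrite ltnS leq_eqVlt => /orP[/eqP jk|jk].
    by rewrite jk in ij *; rewrite W'w W'E // dotC wW.
  by rewrite !W'E ?Wo ?ij // (ltn_trans ij jk).
- move=> x hx; apply: deflated_fix; first by rewrite -W'w hx.
  by apply: Wf => i ik; rewrite -W'E ?hx // ltnW.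
move=> i; rewrite ltnS leq_eqVlt => /orP[/eqP ik|ik]; last first.
  have [b hb] := Wl i ik; exists b => x hx.
  rewrite !W'E ?(ltnW ik) //; apply: hb => l li; rewrite -W'E ?hx //.
  by apply: leq_ltn_trans li (ltnW ik).
move: yE; rewrite -{1}ik => yE.
(* A vector orthogonal to everything found so far is fixed by [Q], so against it [M w_i] and the
   residual are indistinguishable. *)
have xy x : (forall l, (l <= i)%N -> dot (W' l.+1) x = 0) -> dot x y = dot x (Q *m y).
  move=> hx; have Qx : Q *m x = x.
    by apply: Wf => l lk; rewrite -W'E ?hx // -ltnS ik.
  by rewrite (projection_dot _ pQ Qx).
case: wE => [[wE _]|[Qy _]].
  by exists true => x hx; rewrite mul1r ik W'w W'E // -yE xy // wE.
by exists false => x hx; rewrite mul0r W'E ?ik // -yE xy // Qy dot0r.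
Qed.

Lemma eq_three_term (al al' be be' : nat -> R) k :
  (forall i, (i < k)%N -> al i = al' i /\ be i = be' i) ->
  three_term al be k = three_term al' be' k.
Proof.
elim: k => //= k IH h; have [-> ->] := h k (ltnSn k).
by rewrite IH // => i ik; apply: h; apply: ltnW.
Qed.

Lemma lanczos_initP s : ireg s 1 = d ->
  let t := run lanczos_init s in
  [/\ matm t 3 = 1%:M, colm t 9 0 = 0, colm t 10 0 = 0 &
      forall j, (j <= d)%N -> rmem t 14 0%N j = 0 /\ rmem t 14 1%N j = (j == 0%N)%:R].
Proof.
move=> hd; rewrite /= /lanczos_init 4!run_seq.
set s1 := run _ s.
have d1 : ireg s1 1 = d by rewrite -hd; apply: run_iframe.
have e1 : matm s1 3 = 1%:M.
  by apply: matm_mat_set => // i j; rewrite /= delta_nat mxE.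
clearbody s1; set s2 := run _ s1.
have d2 : ireg s2 1 = d by rewrite -d1; apply: run_iframe.
have e2 : matm s2 3 = 1%:M by rewrite -e1; apply: (@same_matm [:: 3]%N); first apply: same_run.
have e2' : colm s2 9 0 = 0 by apply: colm_vec_set => // j; rewrite mxE.
clearbody s2; set s3 := run _ s2.
have d3 : ireg s3 1 = d by rewrite -d2; apply: run_iframe.
have F3 : same [:: 3; 9]%N s2 s3 by apply: same_run.
have e3 : colm s3 10 0 = 0 by apply: colm_vec_set => // j; rewrite mxE.
have e3' : matm s3 3 = 1%:M by rewrite (same_matm F3).
have e3'' : colm s3 9 0 = 0 by rewrite (same_colm _ F3).
clearbody s3; clear s2 d2 e2 e2' F3; set s4 := run _ s3.
have d4 : ireg s4 1 = d by rewrite -d3; apply: run_iframe.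
have F4 : same [:: 3; 9; 10]%N s3 s4 by apply: same_run.
have e4 j : (j <= d)%N -> rmem s4 14 0%N j = 0.
  by move=> hj; rewrite vec_setP //= d3 addn1 ltnS.
clearbody s4; set s5 := run _ s4.
have F5 : same [:: 3; 9; 10]%N s3 s5 by apply: same_trans F4 _; apply: same_run.
split; [by rewrite (same_matm F5)|by rewrite (same_colm _ F5)|by rewrite (same_colm _ F5)|].
move=> j hj; split.
  by rewrite /s5 vec_set_other // e4.
by rewrite vec_setP //= ?delta_nat // d4 addn1 ltnS.
Qed.

Lemma lanczosP s (M : 'M[R]_d) : ireg s 1 = d -> matm s 18 = M -> M^T = M ->
  forall j, (j <= d)%N -> rmem (run lanczos s) 14 d.+1 j = (char_poly M)`_j.
Proof.
move=> hd hM sM; rewrite /lanczos run_seq; set s1 := run _ s.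
have d1 : ireg s1 1 = d by rewrite -hd; apply: run_iframe.
have F1 : same [:: 18]%N s s1 by apply: same_run.
have [i3 i9 i10 i14] := lanczos_initP hd.
rewrite -/s1 in i3 i9 i10 i14; have i18 : matm s1 18 = M by rewrite (same_matm F1).
clearbody s1; clear s hd hM F1.
pose al (W : nat -> 'cV[R]_d) i := dot (W i.+1) (M *m W i.+1) / dot (W i.+1) (W i.+1).
pose be (W : nat -> 'cV[R]_d) i := dot (W i) (M *m W i.+1) / dot (W i) (W i).
pose I k t := [/\ ireg t 1 = d, matm t 18 = M,
  colm t 10 k = (if k is k'.+1 then M *m colm t 9 k else 0),
  lanczos_inv M k (matm t 3) (fun i => colm t 9 i) &
  forall j, (j <= d)%N -> let p := three_term (al (fun i => colm t 9 i))
      (be (fun i => colm t 9 i)) k in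
    rmem t 14 k j = p.1`_j /\ rmem t 14 k.+1 j = p.2`_j].
set c := (lanczos_vector ;; lanczos_poly).
have : I d (run (For 8 dX c) s1).
  apply: for_inv => //.
    split=> //.
      have i3' : matm (tick (icost dX).+1 s1) 3 = 1%:M by exact: i3.
      split=> //; rewrite ?i3'.
      - split; last by rewrite mxtrace1 subr0.
        by split; rewrite ?trmx1 ?mul1mx.
      - by move=> i j; rewrite andbF.
      - by move=> x _; rewrite mul1mx.
    by move=> j /i14 [e0 e1]; rewrite /= coef0 coef1.
  move=> k t kd [td t18 t10 tI tp].
  set t1 := tick 1 _; rewrite /c run_seq.
  (* The trace of the projection is [d - k], which is positive in round [k]. *)
  have piv : exists j, 0 < matm t 3 j j.
    apply: trace_gt0_pivot; have [[_ ->] _ _ _ _] := tI.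
    by rewrite subr_gt0 ltr_nat.
  have [w [wE [w9 o9] [y10 o10] Q3]] :=
    @lanczos_vectorP t1 k (matm t 3) M (colm t 10 k) td erefl erefl t18 erefl piv.
  set t2 := run _ t1 in w9 o9 y10 o10 Q3 *.
  have d2 : ireg t2 1 = d by rewrite -td; apply: (@run_iframe _ 1 _ t1).
  have k2 : ireg t2 8 = k by apply: (@run_iframe _ 8 _ t1).
  have f2 : rmem t2 14 = rmem t 14 by apply: (@run_frame _ 14 _ t1).
  have f2' : rmem t2 18 = rmem t 18 by apply: (@run_frame _ 18 _ t1).
  have o9' i : (i <= k)%N -> colm t2 9 i = colm t 9 i.
    by move=> ik; apply/matrixP => a b; rewrite !mxE o9 // ltn_eqF.
  clearbody t2.
  have [p14 o14] := lanczos_polyP d2 k2 erefl w9 y10.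
  set t3 := run _ t2 in p14 o14 *.
  have F3 : same [:: 3; 9; 10; 18]%N t2 t3 by apply: same_run.
  have d3 : ireg t3 1 = d by rewrite -d2; apply: run_iframe.
  clearbody t3.
  have W9 i : colm t3 9 i = colm t2 9 i by apply: same_colm F3 _.
  have pE : three_term (al (fun i => colm t3 9 i)) (be (fun i => colm t3 9 i)) k =
    three_term (al (fun i => colm t 9 i)) (be (fun i => colm t 9 i)) k.
    apply: eq_three_term => i ik; rewrite /al /be !W9 !o9' //; exact: ltnW.
  split=> //.
  - by rewrite (same_matm F3) // -t18; apply/matrixP => a b; rewrite !mxE f2'.
  - by rewrite (same_colm _ F3) // y10 W9 w9.
  - rewrite (same_matm F3) // Q3; apply: (lanczos_inv_step tI t10 wE) => [i ik|].
      by rewrite W9 o9'.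
    by rewrite W9 w9.
  - move=> j hj; rewrite /= pE; have [p1 p2] := tp j hj; split.
      by rewrite o14 ?f2 // ltn_eqF.
    rewrite p14 // f2 p1 p2 /al /be !W9 w9 o9' //.
    rewrite coefB mulrBl !coefB coefXM !coefCM; congr (_ - _ - _).
    by case: j hj {p1 p2} => //= j hj; rewrite (tp j (ltnW hj)).2.
move=> [_ _ _ [_ W0 Wo _ Wl] tp] j hj.
rewrite (tp j hj).2; congr (_`_j); rewrite (@char_poly_lanczos _ _ _
  (fun i => colm (run (For 8 dX c) s1) 9 i.+1)
  (be (fun i => colm (run (For 8 dX c) s1) 9 i))) //.
by move=> i hi; case: (W0 i hi).
Qed.

End Lanczos.

(** * The candidate list *)

Definition kernel_vector : cmd :=
  mat_set 3 dX dX (RDelta (IVar 3) (IVar 4)) ;;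
  For 8 dX (vec_set 7 (INum 0) dX (RDot 3 (IVar 4) 16 (IVar 8)) ;;
            deflate 7 (INum 0)) ;;
  pick_pivot.

Definition top_eigenvector : cmd :=
  lanczos ;;
  RootR (scal 15) 14 (IAdd dX (INum 1)) dX ;;
  mat_set 16 dX dX
    (ROp Rsub (rc 18 (IVar 3) (IVar 4))
       (ROp Rmul (RDelta (IVar 3) (IVar 4)) (rc 15 (INum 0) (INum 0)))) ;;
  kernel_vector.

(** The weights are tabulated first. Recomputing the inner products for each matrix entry would cost
    O(n d^3) per row instead of O(n d^2). *)
Definition weighted_gram (m : nat) : cmd :=
  vec_set 17 (INum 0) nX (RPow (RDot 0 (IVar 7) 0 (IVar 4)) (2 * m)) ;;
  mat_set 18 dX dX
    (RSum nX (ROp Rmul (rc 17 (INum 0) (IVar 5))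
       (ROp Rmul (rc 0 (IVar 5) (IVar 3)) (rc 0 (IVar 5) (IVar 4))))).

Definition process_row (m : nat) : cmd :=
  normalize 0 (IVar 7) (IVar 7) ;;
  weighted_gram m ;;
  top_eigenvector ;;
  normalize 6 (INum 0) (IAdd nX (IVar 7)).

Definition candidates (m : nat) : cmd :=
  For 7 nX (process_row m) ;; SetI 2 (IAdd nX nX).

Definition eval_row (q : nat) : cmd :=
  vec_set 21 (INum 0) nX (RDot 0 (IVar 4) 1 (IVar 7)) ;;
  set_scal 23 (RSum nX (RPow (rc 21 (INum 0) (IVar 5)) q)) ;;
  IfR (scal 22) (scal 23)
    (set_scal 22 (rc 23 (INum 0) (INum 0)) ;;
     vec_set 24 (INum 0) dX (rc 1 (IVar 7) (IVar 4)))
    Skip.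

(** The running maximum starts at 0. Moments of even order are nonnegative and the comparison in
    [eval_row] is not strict, so the first candidate is always recorded. *)
Definition best_row (q : nat) : cmd :=
  set_scal 22 (RNat (INum 0)) ;; For 7 (IAdd nX nX) (eval_row q).

Definition root_of (a b q : nat) (E : rexp) : cmd :=
  vec_set a (INum 0) (INum q.+1)
    (ROp Rsub (RDelta (IVar 4) (INum q)) (ROp Rmul (RDelta (IVar 4) (INum 0)) E)) ;;
  RootR (scal b) a (INum 0) (INum q).

(** * Correctness of the exact top eigenvector *)

Section Eigen.
Variables (R : realType) (d : nat).
Implicit Types s t : state R.

Local Notation colm s a r := (@colm R d s a%N r%N).
Local Notation matm s a := (@matm R d s a%N).

(** The vector [u0] is orthogonal to all rows, hence fixed by every deflation, and keeps the
    projection nonzero. In the end the projection kills all rows of [A]; being symmetric, it has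
    columns orthogonal to these rows. *)
Lemma kernel_vectorP s (A : 'M[R]_d) (u0 : 'cV[R]_d) :
  ireg s 1 = d -> matm s 16 = A -> u0 != 0 -> A *m u0 = 0 ->
  let u := colm (run kernel_vector s) 6 0 in u != 0 /\ A *m u = 0.
Proof.
move=> hd hA u0n0 Au0; rewrite /= /kernel_vector 2!run_seq.
set s1 := run _ s.
have d1 : ireg s1 1 = d by rewrite -hd; apply: run_iframe.
have e1 : matm s1 3 = 1%:M.
  by apply: matm_mat_set => // i j; rewrite /= delta_nat mxE.
have F1 : rmem s1 16 = rmem s 16 by apply: run_frame.
clearbody s1.
have Arow (i : 'I_d) x : dot (colm s 16 i) x = (A *m x) i 0.
  by rewrite -hA mxE; apply: eq_bigr => j _; rewrite !mxE.
set c := (X in For 8 _ X).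
have : [/\ ireg (run (For 8 dX c) s1) 1 = d,
   projection (matm (run (For 8 dX c) s1) 3),
   rmem (run (For 8 dX c) s1) 16 = rmem s 16,
   matm (run (For 8 dX c) s1) 3 *m u0 = u0 &
   forall i : 'I_d, (i < d)%N -> matm (run (For 8 dX c) s1) 3 *m colm s 16 i = 0].
  apply: (@for_inv R (fun k t => [/\ ireg t 1 = d, projection (matm t 3),
     rmem t 16 = rmem s 16, matm t 3 *m u0 = u0 &
     forall i : 'I_d, (i < k)%N -> matm t 3 *m colm s 16 i = 0])) => //.
    have e1' : matm (tick (icost dX).+1 s1) 3 = 1%:M by exact: e1.
    by split; rewrite ?e1' ?mul1mx //; split; rewrite ?trmx1 ?mul1mx.
  move=> k t kd [td pQ t16 Qu0 Qr]; set t1 := tick 1 _; rewrite /c run_seq.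
  set Q := matm t 3 in pQ Qu0 Qr.
  set t2 := run _ t1.
  have d2 : ireg t2 1 = d by rewrite -td; apply: (@run_iframe _ 1 _ t1).
  have f2 : rmem t2 16 = rmem s 16 by rewrite -t16; apply: (@run_frame _ 16 _ t1).
  have f2' : matm t2 3 = Q by apply/matrixP => a b; rewrite !mxE /t2 run_frame.
  have v2 : colm t2 7 0 = Q *m colm s 16 k.
    apply: colm_vec_set => // j.
    rewrite (@reval_mulmx R d t1 3 16 (IVar 8) j k) //.
    by congr ((_ *m _) _ _); apply/matrixP => a b; rewrite !mxE /= t16.
  clearbody t2.
  have [Q3 _] := @deflateP R d 7 (INum 0) t2 d2 isT isT isT.
  set t3 := run _ t2 in Q3 *.
  have d3 : ireg t3 1 = d by rewrite -d2; apply: run_iframe.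
  have f3 : rmem t3 16 = rmem s 16 by rewrite -f2; apply: run_frame.
  clearbody t3; move: Q3; rewrite /= f2' v2; set a := colm s 16 k; set r := Q *m a.
  move=> Q3; have rQ : Q *m r = r by rewrite /r mulmxA pQ.2.
  split; rewrite ?Q3 //; first exact: projection_deflated.
    apply: deflated_fix => //.
    rewrite dotC (projection_dot _ pQ Qu0) /r !mulmxA pQ.2 -(projection_dot _ pQ Qu0).
    by rewrite dotC /a (Arow (Ordinal kd)) Au0 mxE.
  move=> i; rewrite ltnS leq_eqVlt => /orP[/eqP ik|ik].
    rewrite ik -/a deflated_mul (projection_dot a pQ rQ) -/r.
    by have := deflated_self rQ; rewrite deflated_mul rQ.
  by apply: deflated_ker => //; apply: Qr.
set s2 := run (For _ _ _) s1 => -[d2 pQ f2 Qu0 Qr].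
clearbody s2.
have [|j jpos ->] := @pick_pivotP R d s2 d2.
  apply: projection_pivot => //; apply: contraNneq u0n0 => Q0.
  by rewrite -Qu0 Q0 mul0mx.
split.
  apply/eqP => /matrixP/(_ j 0); rewrite !mxE => j0.
  by move: jpos; rewrite !mxE j0 ltxx.
apply/matrixP => i l; rewrite ord1 -Arow colE mxE dotC dot_mulmx pQ.1.
by rewrite Qr // dot0r.
Qed.

Lemma top_eigenvectorP s (M : 'M[R]_d) : (0 < d)%N ->
  ireg s 1 = d -> matm s 18 = M -> M^T = M ->
  let u := colm (run top_eigenvector s) 6 0 in
  exists2 lam : R, u != 0 /\ M *m u = lam *: u &
    forall v : 'cV[R]_d, dot v (M *m v) <= lam * dot v v.
Proof.
move=> d0 hd hM sM; rewrite /= /top_eigenvector 3!run_seq.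
have cE := lanczosP hd hM sM.
set s1 := run _ s in cE *.
have d1 : ireg s1 1 = d by rewrite -hd; apply: run_iframe.
have F1 : rmem s1 18 = rmem s 18 by apply: run_frame.
clearbody s1; set s2 := run _ s1.
have d2 : ireg s2 1 = d by rewrite -d1; apply: run_iframe.
have F2 : matm s2 18 = M.
  by rewrite -hM; apply/matrixP => a b; rewrite !mxE /s2 run_frame // F1.
have [rlam hlam] := largest_root_rayleigh d0 sM.
have l2 : rmem s2 15 0%N 0%N = largest_root (char_poly M).
  rewrite /s2 (@run_root _ _ _ _ _ _ d.+1 d) /= ?d1 ?addn1 //.
  congr largest_root; apply/polyP => i; rewrite coef_poly; case: ltnP => hi.
    by rewrite cE.
  by rewrite nth_default // size_char_poly.
clearbody s2; set s3 := run _ s2.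
set lam := largest_root _ in rlam hlam l2.
have d3 : ireg s3 1 = d by rewrite -d2; apply: run_iframe.
have A3 : matm s3 16 = M - lam%:M.
  apply: matm_mat_set => // i j; rewrite /= delta_nat l2 -F2 !mxE.
  by rewrite mulr_natl.
clearbody s3.
(* Eigenspaces consist of row vectors, so symmetry of [M] is used to transpose. *)
have [u0 u0n0 Au0] : exists2 u0 : 'cV[R]_d, u0 != 0 & (M - lam%:M) *m u0 = 0.
  move: rlam; rewrite -eigenvalue_root_char => /eigenvalueP[v vM vn0].
  exists v^T; first by rewrite trmx_eq0.
  apply: trmx_inj; rewrite trmx_mul trmxK linearB /= sM tr_scalar_mx mulmxBr vM.
  by rewrite mul_mx_scalar subrr trmx0.
have [un0 Au] := kernel_vectorP d3 A3 u0n0 Au0.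
exists lam => //; split=> //; apply/eqP; rewrite -subr_eq0 -mul_scalar_mx -mulmxBl.
exact/eqP.
Qed.

End Eigen.

Section Rows.
Variables (R : realType) (n d m : nat).
Implicit Types s t : state R.

Local Notation colm s a r := (@colm R d s a%N r%N).
Local Notation matm s a := (@matm R d s a%N).

(** The quadratic form [T_i] of the overview; [gram] is its matrix. *)
Definition mixed (x : 'I_n -> 'cV[R]_d) i (v : 'cV[R]_d) :=
  \sum_j dot (x i) (x j) ^+ (2 * m) * dot (x j) v ^+ 2.

Definition gram (x : 'I_n -> 'cV[R]_d) i : 'M[R]_d :=
  \sum_l dot (x i) (x l) ^+ (2 * m) *: (x l *m (x l)^T).

Lemma gram_sym x i : (gram x i)^T = gram x i.
Proof.
rewrite linear_sum; apply: eq_bigr => l _.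
by rewrite linearZ /= trmx_mul trmxK.
Qed.

Lemma dot_gram x i v : dot v (gram x i *m v) = mixed x i v.
Proof.
rewrite mulmx_suml /mixed.
transitivity (\sum_l dot v (dot (x i) (x l) ^+ (2 * m) *: (x l *m (x l)^T) *m v)).
  rewrite exchange_big; apply: eq_bigr => j _ /=.
  by rewrite summxE mulr_sumr.
apply: eq_bigr => l _; rewrite -scalemxAl -mulmxA dotE mul_mx_scalar !dotZr.
by rewrite (dotC v) expr2.
Qed.

Lemma reval_pow r (M : nat -> nat -> nat -> R) E k :
  reval r M (RPow E k) = reval r M E ^+ k.
Proof. by []. Qed.

Lemma weighted_gramP s (i : 'I_n) :
  ireg s 0 = n -> ireg s 1 = d -> ireg s 7 = i ->
  matm (run (weighted_gram m) s) 18 = gram (fun l : 'I_n => colm s 0 l) i.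
Proof.
move=> n1 d1 i1; rewrite /weighted_gram run_seq; set s2 := run _ s.
have n2 : ireg s2 0 = n by rewrite -n1; apply: run_iframe.
have d2 : ireg s2 1 = d by rewrite -d1; apply: run_iframe.
have F2 : rmem s2 0 = rmem s 0 by apply: run_frame.
have g2 (l : 'I_n) : rmem s2 17 0%N l = dot (colm s 0 i) (colm s 0 l) ^+ (2 * m).
  rewrite vec_setP // ?[ieval _ _]/= ?n1 //.
  by rewrite reval_pow (@reval_dot R d) //= i1.
clearbody s2.
apply: matm_mat_set => // a b; rewrite /= n2 summxE; apply: eq_bigr => l _.
by rewrite g2 F2 !mxE big_ord1 !mxE.
Qed.

Lemma process_rowP s (i : 'I_n) : (0 < d)%N ->
  ireg s 0 = n -> ireg s 1 = d -> ireg s 7 = i ->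
  let x (l : 'I_n) := colm s 0 l in let t := run (process_row m) s in
  [/\ colm t 1 i = normalized (x i),
      dot (colm t 1 (n + i)) (colm t 1 (n + i)) = 1,
      forall v, dot v v = 1 -> mixed x i v <= mixed x i (colm t 1 (n + i)) &
      forall l : nat, l != i -> l != (n + i)%N -> rmem t 1 l = rmem s 1 l].
Proof.
move=> d0 hn hd hi x t; rewrite {}/t /process_row.
rewrite run_seq; set s1 := run _ s; rewrite run_seq; set s3 := run _ s1.
rewrite run_seq; set s4 := run _ s3; set s5 := run _ s4.
have [v1 o1] : colm s1 1 i = normalized (x i) /\
    forall l, l != i :> nat -> rmem s1 1 l = rmem s 1 l.
  have := @normalizeP R d 0 (IVar 7) (IVar 7) s hd isT isT isT isT.
  by rewrite [ieval _ _]/= hi.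
have n1 : ireg s1 0 = n by rewrite -hn; apply: run_iframe.
have d1 : ireg s1 1 = d by rewrite -hd; apply: run_iframe.
have i1 : ireg s1 7 = i by rewrite -hi; apply: run_iframe.
have F1 : rmem s1 0 = rmem s 0 by apply: run_frame.
have x1 : (fun l : 'I_n => colm s1 0 l) = x.
  by apply/funext => l; apply/matrixP => a b; rewrite !mxE F1.
have M3 := weighted_gramP n1 d1 i1; rewrite -/s3 x1 in M3.
clear x1 F1; clearbody s1.
have n3 : ireg s3 0 = n by rewrite -n1; apply: run_iframe.
have d3 : ireg s3 1 = d by rewrite -d1; apply: run_iframe.
have i3 : ireg s3 7 = i by rewrite -i1; apply: run_iframe.
have G3 : rmem s3 1 = rmem s1 1 by apply: run_frame.
clearbody s3.
have [lam [un0 Mu] hlam] := top_eigenvectorP d0 d3 M3 (gram_sym _ _).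
rewrite -/s4 in un0 Mu.
have n4 : ireg s4 0 = n by rewrite -n3; apply: run_iframe.
have d4 : ireg s4 1 = d by rewrite -d3; apply: run_iframe.
have i4 : ireg s4 7 = i by rewrite -i3; apply: run_iframe.
have G4 : rmem s4 1 = rmem s1 1 by rewrite -G3; apply: run_frame.
clearbody s4.
have [v5 o5] : colm s5 1 (n + i) = normalized (colm s4 6 0) /\
    forall l, l != (n + i)%N -> rmem s5 1 l = rmem s4 1 l.
  have := @normalizeP R d 6 (INum 0) (IAdd nX (IVar 7)) s4 d4 isT isT isT isT.
  by rewrite [ieval _ _]/= n4 i4.
clearbody s5.
have v5u : dot (colm s5 1 (n + i)) (colm s5 1 (n + i)) = 1.
  by rewrite v5 dot_normalized.
split=> //.
- rewrite -v1; apply/matrixP => a b; rewrite !mxE o5 ?G4 //.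
  by rewrite ltn_eqF // ltn_addr.
(* A unit eigenvector attains the value [lam], which bounds the form on the unit sphere. *)
- move=> v v1'; rewrite -!dot_gram.
  apply: le_trans (hlam v) _; rewrite v1' -v5u -dotZr v5.
  rewrite /normalized (negbTE un0) -scalemxAr Mu !scalerA.
  by rewrite mulrC lexx.
- by move=> l li lni; rewrite o5 // G4 o1.
Qed.

Lemma candidatesP s : (0 < d)%N -> ireg s 0 = n -> ireg s 1 = d ->
  let x (l : 'I_n) := colm s 0 l in let t := run (candidates m) s in
  [/\ ireg t 0 = n, ireg t 1 = d, ireg t 2 = (n + n)%N, rmem t 0 = rmem s 0 &
  forall i : 'I_n,
  [/\ colm t 1 i = normalized (x i),
      dot (colm t 1 (n + i)) (colm t 1 (n + i)) = 1 &
      forall v, dot v v = 1 -> mixed x i v <= mixed x i (colm t 1 (n + i))]].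
Proof.
move=> d0 hn hd x t; rewrite {}/t /candidates run_seq.
pose I k t := [/\ ireg t 0 = n, ireg t 1 = d, rmem t 0 = rmem s 0 &
  forall i : 'I_n, (i < k)%N ->
  [/\ colm t 1 i = normalized (x i),
      dot (colm t 1 (n + i)) (colm t 1 (n + i)) = 1 &
      forall v, dot v v = 1 -> mixed x i v <= mixed x i (colm t 1 (n + i))]].
have : I n (run (For 7 nX (process_row m)) s).
  apply: for_inv => // k t kn [t0 t1 tX th]; set u := tick 1 _.
  have [] := @process_rowP u (Ordinal kn) d0 t0 t1 erefl.
  have xE (l : 'I_n) : colm u 0 l = x l.
    by apply/matrixP => a b; rewrite !mxE /= tX.
  have -> : (fun l : 'I_n => colm u 0 l) = x by apply/funext.
  rewrite xE.
  set w := run _ u => w1 w2 w3 wo.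
  have F x' : ~~ iwrites x' (process_row m) -> ireg w x' = ireg u x'.
    exact: run_iframe.
  split; rewrite ?F //; first by rewrite -tX; apply: (@run_frame _ 0 _ u).
  move=> i; rewrite ltnS leq_eqVlt => /orP[/eqP ik|ik].
    have -> : i = Ordinal kn by apply: val_inj; rewrite /= ik.
    by split.
  have [h1 h2 h3] := th i ik; have ni := ltn_ord i.
  have e1 : colm w 1 i = colm t 1 i.
    apply/matrixP => a b; rewrite !mxE wo //=; first by rewrite ltn_eqF.
    by rewrite ltn_eqF // ltn_addr.
  have e2 : colm w 1 (n + i) = colm t 1 (n + i).
    apply/matrixP => a b; rewrite !mxE wo //=.
      by rewrite gtn_eqF // ltn_addr.
    by rewrite eqn_add2l ltn_eqF.
  by rewrite e1 e2.
move: (run (For _ _ _) s) => t [t0 t1 tX th].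
by split=> //; [rewrite -[RHS]/(n + n)%N -{1}t0 -{1}t0|move=> i; have [] := th i (ltn_ord i)].
Qed.

Definition moment (q : nat) (x : 'I_n -> 'cV[R]_d) (v : 'cV[R]_d) :=
  \sum_j dot (x j) v ^+ q.

Lemma best_rowP q s : ~~ odd q -> (0 < n)%N -> ireg s 0 = n -> ireg s 1 = d ->
  let F := moment q (fun l => colm s 0 l) in let t := run (best_row q) s in
  exists2 k, (k < n + n)%N /\ colm t 24 0 = colm s 1 k &
    rmem t 22 0%N 0%N = F (colm s 1 k) /\
    forall l, (l < n + n)%N -> F (colm s 1 l) <= F (colm s 1 k).
Proof.
move=> oq n0 hn hd F; rewrite /= /best_row run_seq; set s1 := run _ s.
have n1 : ireg s1 0 = n by rewrite -hn; apply: run_iframe.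
have d1 : ireg s1 1 = d by rewrite -hd; apply: run_iframe.
have b1 : rmem s1 22 0%N 0%N = 0 by rewrite set_scalP.
have F1 : rmem s1 0 = rmem s 0 /\ rmem s1 1 = rmem s 1 by split; apply: run_frame.
clearbody s1.
have F_ge0 v : 0 <= F v.
  by apply: sumr_ge0 => j _; rewrite exprn_even_ge0.
pose I k t := [/\ ireg t 0 = n /\ ireg t 1 = d, rmem t 0 = rmem s 0,
  rmem t 1 = rmem s 1 &
  if k is 0 then rmem t 22 0%N 0%N = 0 else
  exists2 k', (k' < k)%N /\ colm t 24 0 = colm s 1 k' &
    rmem t 22 0%N 0%N = F (colm s 1 k') /\
    forall l, (l < k)%N -> F (colm s 1 l) <= F (colm s 1 k')].
have : I (n + n)%N (run (For 7 (IAdd nX nX) (eval_row q)) s1).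
  apply: for_inv => /=; first by rewrite n1.
    by case: F1.
  move=> k t kn [[t0 t1] tX tV th]; set u := tick 1 _.
  rewrite /eval_row 2!run_seq; set u1 := run _ u.
  have n1' : ireg u1 0 = n by rewrite -t0; apply: (@run_iframe _ 0 _ u).
  have d1' : ireg u1 1 = d by rewrite -t1; apply: (@run_iframe _ 1 _ u).
  have k1' : ireg u1 7 = k by apply: (@run_iframe _ 7 _ u).
  have G1 : same [:: 0; 1; 22; 24]%N t u1 by apply: (@same_run _ _ _ u).
  have h1 (l : 'I_n) : rmem u1 21 0%N l = dot (colm s 0 l) (colm s 1 k).
    rewrite vec_setP // ?[ieval _ _]/= ?t0 //.
    by rewrite (@reval_dot R d) //= tX tV.
  clearbody u1; set u2 := run _ u1.
  have n2' : ireg u2 0 = n by rewrite -n1'; apply: run_iframe.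
  have d2' : ireg u2 1 = d by rewrite -d1'; apply: run_iframe.
  have k2' : ireg u2 7 = k by rewrite -k1'; apply: run_iframe.
  have G2 : same [:: 0; 1; 22; 24]%N t u2 by apply: same_trans G1 _; apply: same_run.
  have f2 : rmem u2 23 0%N 0%N = F (colm s 1 k).
    rewrite set_scalP //= n1'; apply: eq_bigr => l _; by rewrite h1.
  clearbody u2; clear u1 n1' d1' k1' G1 h1.
  have best : rmem u2 22 0%N 0%N <= F (colm s 1 k) ->
      forall l, (l < k.+1)%N -> F (colm s 1 l) <= F (colm s 1 k).
    rewrite G2 // => le l; rewrite ltnS leq_eqVlt => /orP[/eqP->//|lk].
    case: k th le lk {kn u k2' f2} => // k [k' _ [-> h]] le lk.
    exact: le_trans (h l lk) le.
  rewrite run_if /getr [cell_arr _]/= f2; case: leP => le.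
    rewrite run_seq; set t3 := tick _ u2; set u3 := run _ t3.
    have G3 : same [:: 0; 1]%N t u3.
      move=> y hy; rewrite -(G2 y).
        by apply: (@same_run _ [:: 0; 1]%N _ t3).
      by move: hy; rewrite !inE => /orP[]->; rewrite ?orbT.
    have n3' : ireg u3 0 = n by rewrite -n2'; apply: (@run_iframe _ 0 _ t3).
    have d3' : ireg u3 1 = d by rewrite -d2'; apply: (@run_iframe _ 1 _ t3).
    have k3' : ireg u3 7 = k by rewrite -k2'; apply: (@run_iframe _ 7 _ t3).
    have b3 : rmem u3 22 0%N 0%N = F (colm s 1 k) by rewrite set_scalP //= f2.
    clearbody u3; set u4 := run _ u3.
    have G4 : same [:: 0; 1]%N t u4 by apply: same_trans G3 _; apply: same_run.
    split.
    - by split; [rewrite -n3'|rewrite -d3']; apply: run_iframe.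
    - by rewrite G4.
    - by rewrite G4.
    exists k; split=> //.
    - apply: colm_vec_set => // j; by rewrite /= k3' G3 // tV mxE.
    - by rewrite run_frame.
    - exact: best.
  rewrite -[run Skip _]/(tick 1 _); set u3 := tick 1 _.
  split=> //; [by rewrite G2|by rewrite G2|].
  case: k th le {kn u best k2' f2} => [|k] th le.
    by move: le; rewrite G2 // th ltNge F_ge0.
  move: th le => [k' [kk' e24] [e22 h]] le; exists k'.
    split; first exact: ltnW.
    by rewrite -e24; apply/matrixP => a b; rewrite !mxE /= G2.
  split; first by rewrite -e22 /= G2.
  move=> l; rewrite ltnS leq_eqVlt => /orP[/eqP->|lk]; last exact: h.
  by rewrite -e22 -(G2 22%N) // ltW.
move=> [_ _ _]; case E: (n + n)%N => [|k]; first by move: n0 E; case: (n).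
by [].
Qed.

Lemma root_ofP a b q E s (c : R) : (0 < q)%N -> 0 <= c -> vec_ok a (INum 0) E ->
  (forall j, reval (update (ireg s) 4 j) (rmem s) E = c) ->
  rmem (run (root_of a b q E) s) b 0%N 0%N = c `^ q%:R^-1.
Proof.
move=> q0 c0 ok hE; rewrite /root_of run_seq (@run_root _ _ _ _ _ _ 0 q) //.
rewrite -largest_root_Xn_sub //.
congr largest_root; apply/polyP => i; rewrite !coef_poly; case: ltnP => // hi.
by rewrite vec_setP //= !delta_nat hE.
Qed.

End Rows.

(** * Approximation guarantees *)

Section Conclusion.
Variables (R : realType) (n d m : nat) (X : 'M[R]_(n, d)).
Hypotheses (n_gt0 : (0 < n)%N) (d_gt0 : (0 < d)%N).

Local Notation q := (2 * m + 2)%N.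
Local Notation factor := (d%:R `^ (4^-1 - (2 * q%:R)^-1) : R).

Let x (l : 'I_n) : 'cV[R]_d := (row l X)^T.
Let F := moment q x.

Lemma mulmx_dot v l : (X *m v) l 0 = dot (x l) v.
Proof. by rewrite mxE; apply: eq_bigr => j _; rewrite !mxE. Qed.

Lemma moment_ge0 v : 0 <= F v.
Proof. by apply: sumr_ge0 => j _; rewrite -mulnSr exprM exprn_ge0 // sqr_ge0. Qed.

Lemma expnormE v : expnorm q%:R (X *m v) = (n%:R^-1 * F v) `^ q%:R^-1.
Proof.
congr ((_ * _) `^ _); apply: eq_bigr => l _; rewrite mulmx_dot powR_mulrn //.
by rewrite -normrX ger0_norm // -mulnSr exprM exprn_ge0 // sqr_ge0.
Qed.

Lemma expnorm_ge0 v : 0 <= expnorm q%:R (X *m v).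
Proof. exact: powR_ge0. Qed.

(** Because [q = 2 m + 2], the exponent [m / (2 q)] is [(q - 2) / (4 q)]; it vanishes for
    [q = 2]. *)
Lemma root_factor : (Num.sqrt (d%:R ^+ m) : R) `^ q%:R^-1 = factor.
Proof.
rewrite -powR12_sqrt ?exprn_ge0 // -powR_mulrn // -!powRrM; congr (_ `^ _).
rewrite natrD natrM; field; rewrite -natrM -natrD pnatr_eq0; lia.
Qed.

Lemma expnorm_le_factor v w : F v <= F w * Num.sqrt (d%:R ^+ m) ->
  expnorm q%:R (X *m v) <= factor * expnorm q%:R (X *m w).
Proof.
move=> h; rewrite !expnormE -root_factor -powRM ?sqrtr_ge0 //; last first.
  by rewrite mulr_ge0 ?invr_ge0 // moment_ge0.
apply: ge0_ler_powR; rewrite ?nnegrE ?invr_ge0 ?mulr_ge0 ?invr_ge0 ?moment_ge0 ?sqrtr_ge0 //.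
by rewrite mulrCA ler_wpM2l ?invr_ge0 // mulrC.
Qed.

Variable v_ : nat -> 'cV[R]_d.
Hypothesis v_P : forall i : 'I_n,
  [/\ v_ i = normalized (x i), dot (v_ (n + i)) (v_ (n + i)) = 1 &
      forall v, dot v v = 1 -> mixed m x i v <= mixed m x i (v_ (n + i))].

Lemma candidate_unit k : (k < n + n)%N -> dot (v_ k) (v_ k) = 1.
Proof.
move=> hk; case: (ltnP k n) => [kn|nk].
  by have [-> _ _] := v_P (Ordinal kn); rewrite dot_normalized.
have kn : (k - n < n)%N by rewrite ltn_subLR.
by have [_ + _] := v_P (Ordinal kn); rewrite /= subnKC.
Qed.

Lemma candidate_bound v B : dot v v = 1 ->
  (forall k, (k < n + n)%N -> F (v_ k) <= B) -> F v <= B * Num.sqrt (d%:R ^+ m).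
Proof.
move=> v1 hB; have hB1 (i : 'I_n) : F (v_ i) <= B by apply: hB; rewrite ltn_addr.
have hB2 (i : 'I_n) : F (v_ (n + i)) <= B by apply: hB; rewrite ltn_add2l.
have B0 : 0 <= B by apply: le_trans (moment_ge0 _) (hB1 (Ordinal n_gt0)).
apply: tensor_bound => // i; have [vi _ vm] := v_P i.
apply: le_trans (vm v v1) _; rewrite /mixed.
have r2 : Num.sqrt (dot (x i) (x i)) ^+ 2 = dot (x i) (x i).
  by rewrite sqr_sqrtr // dot_ge0.
(* Row [x_i] is [|x_i|] times the listed vector [v_ i], so [|x_i| ^ (2 m)] factors out and only
   candidates remain in the mixed sum. *)
under eq_bigr => j _.
  rewrite (normalizedK (x i)) -vi dotZl exprMn exprM r2 -mulrA; over.
rewrite -mulr_sumr mulrC ler_wpM2r ?exprn_ge0 ?dot_ge0 //.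
exact: mixed_moment_bound (hB1 i) (hB2 i).
Qed.

Variable k0 : nat.
Hypothesis k0_lt : (k0 < n + n)%N.
Hypothesis k0_max : forall k, (k < n + n)%N -> F (v_ k) <= F (v_ k0).

Lemma expnorm_le_best v : norm2 v = 1 ->
  expnorm q%:R (X *m v) <= factor * expnorm q%:R (X *m v_ k0).
Proof.
by move=> /norm2_eq1 v1; apply: expnorm_le_factor; apply: candidate_bound.
Qed.

Lemma norm2to_le_best : norm2to q%:R X <= factor * expnorm q%:R (X *m v_ k0).
Proof.
apply: ge_sup; last by move=> _ [v /= v1 <-]; apply: expnorm_le_best.
exists (expnorm q%:R (X *m v_ k0)), (v_ k0) => //=.
by apply/norm2_eq1; apply: candidate_unit.
Qed.

(** The set under [sup] must be bounded above; the approximation guarantee itself provides the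
    bound. *)
Lemma expnorm_le_norm2to v : norm2 v = 1 -> expnorm q%:R (X *m v) <= norm2to q%:R X.
Proof.
move=> v1; apply: sup_upper_bound; last by exists v.
split; first by exists (expnorm q%:R (X *m v)), v.
exists (factor * expnorm q%:R (X *m v_ k0)) => _ [w /= w1 <-].
exact: expnorm_le_best.
Qed.

End Conclusion.

(** * The certifying and maximizing programs *)

Section Programs.
Variables (R : realType) (m : nat).
Local Notation q := (2 * m + 2)%N.

(** The approximation factor is obtained as the [4 q]-th root of [d ^ (2 m)], since
    [2 m / (4 q) = 1/4 - 1/(2 q)]. *)
Definition certify : cmd :=
  candidates m ;; best_row q ;;
  root_of 19 20 q (ROp Rdiv (rc 22 (INum 0) (INum 0)) (RNat nX)) ;;
  root_of 25 26 (4 * q) (RPow (RNat dX) (2 * m)) ;;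
  set_scal 1 (ROp Rmul (rc 26 (INum 0) (INum 0)) (rc 20 (INum 0) (INum 0))).

Definition maximize : cmd :=
  candidates m ;; best_row q ;; vec_set 1 (INum 0) dX (rc 24 (INum 0) (IVar 4)).

Variables (n d : nat) (X : 'M[R]_(n, d)).
Hypotheses (n_gt0 : (0 < n)%N) (d_gt0 : (0 < d)%N).

Let x (l : 'I_n) : 'cV[R]_d := (row l X)^T.

Lemma colm_init (l : 'I_n) : colm d (init X) 0 l = x l.
Proof. by apply/matrixP => j k; rewrite ord1 !mxE /= !valK. Qed.

Lemma candidates_init : let t := run_on (candidates m) X in
  [/\ ireg t 0 = n, ireg t 1 = d, ireg t 2 = (n + n)%N,
      forall l : 'I_n, colm d t 0 l = x l &
  forall i : 'I_n, let v_ := row_of_memory d t in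
  [/\ v_ i = normalized (x i), dot (v_ (n + i)%N) (v_ (n + i)%N) = 1 &
      forall v, dot v v = 1 -> mixed m x i v <= mixed m x i (v_ (n + i)%N)]].
Proof.
have xE : (fun l : 'I_n => colm d (init X) 0 l) = x by apply/funext; apply: colm_init.
have [t0 t1 t2 tX th] := @candidatesP R n d m (init X) d_gt0 erefl erefl.
split=> // [l|i].
  by rewrite -colm_init; apply/matrixP => j k; rewrite !mxE tX.
by have := th i; rewrite xE colm_init.
Qed.

Lemma best_row_init : let t := run_on (candidates m) X in
  let v_ := row_of_memory d t in let u := run (best_row q) t in
  exists2 k, (k < n + n)%N /\ colm d u 24 0 = v_ k &
    rmem u 22 0%N 0%N = moment q x (v_ k) /\
    forall l, (l < n + n)%N -> moment q x (v_ l) <= moment q x (v_ k).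
Proof.
have [t0 t1 _ tX _] := candidates_init.
have oq : ~~ odd q by rewrite addn2 /= negbK oddM.
have := @best_rowP R n d q _ oq n_gt0 t0 t1.
by have -> : (fun l : 'I_n => colm d (run_on (candidates m) X) 0 l) = x by apply/funext.
Qed.

Lemma certifyP (w : 'cV[R]_d) :
  let u := run (best_row q) (run_on (candidates m) X) in
  rmem u 22 0%N 0%N = moment q x w ->
  out_num (certify) X =
  d%:R `^ (4^-1 - (2 * q%:R)^-1) * expnorm q%:R (X *m w).
Proof.
move=> u; have [t0 t1 _ _ _] := candidates_init.
have u0 : ireg u 0 = n by rewrite -t0; apply: run_iframe.
have u1 : ireg u 1 = d by rewrite -t1; apply: run_iframe.
rewrite /out_num /run_on /certify 4!run_seq -/(run_on (candidates m) X) -/u.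
clearbody u => u22.
have w0 : 0 <= moment q x w / n%:R by rewrite divr_ge0 ?moment_ge0.
have d0 : 0 <= (d%:R : R) ^+ (2 * m) by rewrite exprn_ge0.
set u' := run _ u.
have e1 : rmem u' 20 0%N 0%N = (moment q x w / n%:R) `^ q%:R^-1.
  by apply: root_ofP => // [|j]; [rewrite addn2|rewrite /= u22 u0].
have u1' : ireg u' 1 = d by rewrite -u1; apply: run_iframe.
clearbody u'; set u'' := run _ u'.
have e2 : rmem u'' 26 0%N 0%N = (d%:R ^+ (2 * m)) `^ (4 * q)%:R^-1.
  by apply: root_ofP => // [|j]; [rewrite addn2|rewrite /= u1'].
have e1' : rmem u'' 20 0%N 0%N = (moment q x w / n%:R) `^ q%:R^-1.
  by rewrite /u'' run_frame.
clearbody u''; rewrite set_scalP //= e1' e2 expnormE [n%:R^-1 * _]mulrC.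
congr (_ * _); rewrite -powR_mulrn // -powRrM; congr (_ `^ _).
rewrite !natrM natrD natrM; field; rewrite -natrM -natrD pnatr_eq0; lia.
Qed.

Lemma maximizeP :
  out_vec maximize X = colm d (run (best_row q) (run_on (candidates m) X)) 24 0.
Proof.
rewrite /out_vec /run_on /maximize 2!run_seq -/(run_on (candidates m) X).
have [_ t1 _ _ _] := candidates_init; set u := run (best_row q) _.
have u1 : ireg u 1 = d by rewrite -t1; apply: run_iframe.
clearbody u; apply: colm_vec_set => // j; by rewrite /= mxE.
Qed.

End Programs.

Theorem theorem3p1 (R : realType) (q : nat) (q_gt0 : (0 < q)%N)
    (q_even : ~~ odd q) :
  let factor (d : nat) : R := d%:R `^ (4^-1 - (2 * q%:R)^-1) in
  [/\ exists P : cmd,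
        [/\ time_bounded R P,
            exists C : nat, forall (n d : nat) (X : 'M[R]_(n, d)),
              (0 < n)%N -> (0 < d)%N -> (size (out_list P X) <= C * (n + d))%N
          & forall (n d : nat) (X : 'M[R]_(n, d)), (0 < n)%N -> (0 < d)%N ->
              let L := out_list P X in
              let best := \big[Num.max/0]_(v <- L) expnorm q%:R (X *m v) in
              [/\ L <> [::],
                  forall v, v \in L -> norm2 v = 1,
                  norm2to q%:R X <= factor d * best
                & factor d * best <= factor d * norm2to q%:R X]],
      exists P : cmd,
        time_bounded R P /\
        forall (n d : nat) (X : 'M[R]_(n, d)), (0 < n)%N -> (0 < d)%N ->
          norm2to q%:R X <= out_num P X /\
          forall alpha : R, 0 < alpha -> norm2to q%:R X <= alpha ->
            out_num P X <= alpha * factor d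
    & exists P : cmd,
        time_bounded R P /\
        forall (n d : nat) (X : 'M[R]_(n, d)), (0 < n)%N -> (0 < d)%N ->
          norm2 (out_vec P X) = 1 /\
          norm2to q%:R X / factor d <= expnorm q%:R (X *m out_vec P X)].
Proof.
have [m ->] : exists m, q = (2 * m + 2)%N.
  exists (q./2.-1); have := odd_double_half q; rewrite (negbTE q_even); lia.
move=> factor.
have factor_gt0 d : (0 < d)%N -> 0 < factor d by move=> d0; rewrite powR_gt0 ?ltr0n.
split.
- exists (candidates m); split; first exact: fits_time_bounded.
    exists 2%N => n d X n0 d0; have [_ _ t2 _ _] := candidates_init m X d0.
    by rewrite size_map size_iota t2; lia.
  move=> n d X n0 d0 L best; have [_ _ t2 _ v_P] := candidates_init m X d0.
  have [k [k_lt _] [_ k_max]] := best_row_init m X n0 d0.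
  have memL l : (l < n + n)%N -> row_of_memory d (run_on (candidates m) X) l \in L.
    by move=> hl; apply: map_f; rewrite mem_iota t2.
  have unitL v : v \in L -> norm2 v = 1.
    move=> /mapP[l]; rewrite mem_iota t2 => hl ->; apply/norm2_eq1.
    exact: (candidate_unit d0 v_P).
  split=> //.
  + by move=> L0; have := memL k k_lt; rewrite L0.
  + apply: le_trans (norm2to_le_best n0 d0 v_P k_lt k_max) _.
    rewrite ler_wpM2l ?powR_ge0 //.
    pose f v := expnorm (2 * m + 2)%N%:R (X *m v).
    exact: (@le_bigmax_seq _ _ _ L 0 _ xpredT f (memL k k_lt) isT).
  (* The maximum has 0 as its starting value, which is harmless because the norms are
     nonnegative. *)
  + rewrite ler_wpM2l ?powR_ge0 // /best big_seq; apply: bigmax_le => [|v vL].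
      apply: le_trans (expnorm_ge0 m X (row_of_memory d (run_on (candidates m) X) k)) _.
      by apply: (expnorm_le_norm2to n0 d0 v_P k_max); apply: unitL; apply: memL.
    by apply: (expnorm_le_norm2to n0 d0 v_P k_max); apply: unitL.
- exists (certify m); split; first exact: fits_time_bounded.
  move=> n d X n0 d0; have [_ _ _ _ v_P] := candidates_init m X d0.
  have [k [k_lt _] [kE k_max]] := best_row_init m X n0 d0.
  rewrite (certifyP n0 d0 kE); split; first exact: (norm2to_le_best n0 d0 v_P k_lt k_max).
  move=> alpha _ ha; rewrite mulrC ler_wpM2r ?powR_ge0 //; apply: le_trans ha.
  apply: (expnorm_le_norm2to n0 d0 v_P k_max); apply/norm2_eq1.
  exact: (candidate_unit d0 v_P).
- exists (maximize m); split; first exact: fits_time_bounded.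
  move=> n d X n0 d0; have [_ _ _ _ v_P] := candidates_init m X d0.
  have [k [k_lt kE] [_ k_max]] := best_row_init m X n0 d0.
  rewrite (maximizeP m X d0) kE; split.
    by apply/norm2_eq1; apply: (candidate_unit d0 v_P).
  rewrite ler_pdivrMr ?factor_gt0 // mulrC.
  exact: (norm2to_le_best n0 d0 v_P k_lt k_max).
Qed.
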